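(* Let $U\subset\mathbb R^n$ be an open neighborhood of $0$ and $f\in\hat{\mathcal E}(U)$ with $\Gamma_+(f)\neq\emptyset$. Let $\Sigma$ be a simplicial subdivision of the fan $\Sigma_0$ associated with $\Gamma_+(f)$ and $\sigma\in\Sigma^{(n)}$ with skeleton $a^1(\sigma),\dots,a^n(\sigma)\in\mathbb Z_+^n$. Then there exists a $C^\infty$ function $f_\sigma$ on $\pi(\sigma)^{-1}(U)$ with $f_\sigma(0)\ne0$ and $$f(\pi(\sigma)(y))=\Big(\prod_{j=1}^ny_j^{l(a^j(\sigma))}\Big)f_\sigma(y)\qquad\text{for }y\in\pi(\sigma)^{-1}(U).$$ Furthermore, if $f$ is nondegenerate over $\mathbb R$ with respect to $\Gamma_+(f)$ and $I\subset\{1,\dots,n\}$ satisfies $\pi(\sigma)(T_I^*(\mathbb R^n))=\{0\}$, then at every point $y\in T_I^*(\mathbb R^n)\cap\pi(\sigma)^{-1}(U)$ with $f_\sigma(y)=0$, the gradient of the restriction of $f_\sigma$ to $T_I^*(\mathbb R^n)$ (i.e. $(\partial f_\sigma/\partial y_j)_{j\notin I}$) does not vanish.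
   Context: $\pi(\sigma):\mathbb R^n\to\mathbb R^n$ is $(x_1,\dots,x_n)=\pi(\sigma)(y)$ with $x_k=\prod_{j=1}^ny_j^{a^j_k(\sigma)}$, where $a^j(\sigma)=(a^j_1(\sigma),\dots,a^j_n(\sigma))$. $T_I^*(\mathbb R^n)=\{y\in\mathbb R^n:y_j=0\iff j\in I\}$. Notation: $H(a,l)=\{x:\langle a,x\rangle=l\}$, $H^+(a,l)=\{x:\langle a,x\rangle\ge l\}$; polyhedron: finite intersection of $H^+(a,l)$, $(a,l)\in\mathbb Z^n\times\mathbb Z$; $(a,l)$ valid for $P$ if $P\subset H^+(a,l)$; faces are $P\cap H(a,l)$ for valid $(a,l)$; $(a,l)$ defines $\gamma$ if $P\cap H(a,l)=\gamma$. Newton polyhedron $\Gamma_+(f)$: convex hull of $\bigcup\{\alpha+\mathbb R_+^n:c_\alpha\ne0\}$. $\gamma$-part and classes: for polyhedron $P\subset\mathbb R_+^n$ with $P+\mathbb R_+^n\subset P$, $\Gamma_+(f)\subset P$, face $\gamma$: $f$ admits the $\gamma$-part on $U$ if for all $x\in U$, $\lim_{t\to0^+}f(t^{a_1}x_1,\dots,t^{a_n}x_n)/t^l$ exists for all valid $(a,l)\in\mathbb Z_+^n\times\mathbb Z_+$ defining $\gamma$ (value $f_\gamma(x)$). $\hat{\mathcal E}[P](U)$: smooth $f$ on $U$ with $\Gamma_+(f)\subset P$ admitting all $\gamma$-parts; $\hat{\mathcal E}(U)=\{f:f\in\hat{\mathcal E}[\Gamma_+(f)](U)\}$. Nondegeneracy: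 for every compact face $\gamma$ of $\Gamma_+(f)$, $f_\gamma=\sum_{\alpha\in\gamma}c_\alpha x^\alpha$ has $\nabla f_\gamma\ne0$ on $U\cap(\mathbb R\setminus\{0\})^n$. Fan: $l(a)=\min\{\langle a,\alpha\rangle:\alpha\in\Gamma_+(f)\}$; for each face $\gamma$, $\gamma^*=\{a\in\mathbb R_+^n:H(a,l(a))\cap\Gamma_+(f)=\gamma\}$; closures of $\gamma^*$ form $\Sigma_0$; a simplicial subdivision $\Sigma$ has the same support $\mathbb R_+^n$, each cone inside a cone of $\Sigma_0$, and each cone's skeleton (primitive integer edge vectors) completable to a basis of $\mathbb Z^n$; $\Sigma^{(n)}$ = its $n$-dimensional cones. *)

(* Defs.v *)
From Stdlib Require Import Reals ZArith List.
From mathcomp Require Import ssreflect ssrfun ssrbool eqtype ssrnat seq fintype bigop.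
Set Implicit Arguments. Unset Strict Implicit. Unset Printing Implicit Defensive.
Open Scope R_scope.

Definition vec (n : nat) := 'I_n -> R.
Definition mindex (n : nat) := 'I_n -> nat.
Definition zero (n : nat) : vec n := fun _ => 0.
Arguments zero n : clear implicits.
Definition natv n (a : mindex n) : vec n := fun i => INR (a i).
Definition Zv n (a : 'I_n -> Z) : vec n := fun i => IZR (a i).
Definition dotR n (a x : vec n) : R := \big[Rplus/0]_(i < n) (a i * x i).

Definition near n (x y : vec n) (d : R) : Prop := forall i, Rabs (y i - x i) < d.
Definition is_open n (V : vec n -> Prop) : Prop :=
  forall x, V x -> exists d, 0 < d /\ forall y, near x y d -> V y.
Definition cont_on n (V : vec n -> Prop) (f : vec n -> R) : Prop :=
  forall x, V x -> forall eps, 0 < eps ->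
    exists d, 0 < d /\ forall y, V y -> near x y d -> Rabs (f y - f x) < eps.
Definition closure n (A : vec n -> Prop) (x : vec n) : Prop :=
  forall eps, 0 < eps -> exists y, A y /\ near x y eps.

Definition upd n (x : vec n) (j : 'I_n) (t : R) : vec n :=
  fun i => if i == j then t else x i.
Definition has_partial n (f : vec n -> R) (j : 'I_n) (x : vec n) (d : R) : Prop :=
  derivable_pt_lim (fun t => f (upd x j t)) (x j) d.
Fixpoint Ck (n k : nat) (V : vec n -> Prop) (f : vec n -> R) {struct k} : Prop :=
  match k with
  | O => cont_on V f
  | S k' => cont_on V f /\
      forall j : 'I_n, exists g : vec n -> R,
        (forall x, V x -> has_partial f j x (g x)) /\ Ck k' V g
  end.
Definition smooth_on n (V : vec n -> Prop) (f : vec n -> R) : Prop :=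
  forall k, Ck k V f.

Inductive iter_partial n (V : vec n -> Prop) :
    list 'I_n -> (vec n -> R) -> (vec n -> R) -> Prop :=
| ip_nil f : iter_partial V nil f f
| ip_cons j js f g h :
    (forall x, V x -> has_partial f j x (g x)) ->
    iter_partial V js g h -> iter_partial V (j :: js) f h.
Definition mlist n (al : mindex n) : list 'I_n :=
  flatten [seq nseq (al j) j | j <- enum 'I_n].
Definition fact_m n (al : mindex n) : R := \big[Rmult/1]_(i < n) INR (fact (al i)).
Definition taylor_coef n (V : vec n -> Prop) (f : vec n -> R) (al : mindex n) (c : R) : Prop :=
  exists h, iter_partial V (mlist al) f h /\ c = h (zero n) / fact_m al.
Definition in_supp n V (f : vec n -> R) (al : mindex n) : Prop :=
  exists c, taylor_coef V f al c /\ c <> 0.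

(** Newton polyhedron: convex hull of the union of al + R_+^n, c_al <> 0 *)
Definition Newton n (V : vec n -> Prop) (f : vec n -> R) (x : vec n) : Prop :=
  exists l : list (R * mindex n * vec n),
    (forall q, In q l -> 0 <= fst (fst q) /\ in_supp V f (snd (fst q)) /\
                         forall i, INR (snd (fst q) i) <= snd q i) /\
    fold_right Rplus 0 (map (fun q => fst (fst q)) l) = 1 /\
    forall i, x i = fold_right Rplus 0 (map (fun q => fst (fst q) * snd q i) l).

Definition valid n (P : vec n -> Prop) (a : 'I_n -> Z) (l : Z) : Prop :=
  forall x, P x -> IZR l <= dotR (Zv a) x.
Definition defines n (P : vec n -> Prop) (a : 'I_n -> Z) (l : Z) (g : vec n -> Prop) : Prop :=
  forall x, g x <-> (P x /\ dotR (Zv a) x = IZR l).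
Definition is_face n (P g : vec n -> Prop) : Prop :=
  exists a l, valid P a l /\ defines P a l g.

Definition tpow n (a : mindex n) (t : R) (x : vec n) : vec n := fun i => t ^ (a i) * x i.
Definition natZ n (a : mindex n) : 'I_n -> Z := fun i => Z.of_nat (a i).
Definition admits_part n (P U : vec n -> Prop) (f : vec n -> R) (g : vec n -> Prop) : Prop :=
  forall (a : mindex n) (l : nat),
    valid P (natZ a) (Z.of_nat l) -> defines P (natZ a) (Z.of_nat l) g ->
    forall x, U x -> exists L,
      limit1_in (fun t => f (tpow a t x) / t ^ l)
                (fun t => 0 < t /\ U (tpow a t x)) L 0.
Definition hatE n (U : vec n -> Prop) (f : vec n -> R) : Prop :=
  smooth_on U f /\
  forall g, is_face (Newton U f) g -> admits_part (Newton U f) U f g.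

Definition bounded n (g : vec n -> Prop) : Prop :=
  exists B, forall x, g x -> forall i, Rabs (x i) <= B.
Definition compact_face n (P g : vec n -> Prop) : Prop :=
  is_face P g /\ (exists x, g x) /\ bounded g.
Definition mono n (al : mindex n) (x : vec n) : R := \big[Rmult/1]_(i < n) (x i ^ al i).
Definition poly_of n (S : list (mindex n * R)) (x : vec n) : R :=
  fold_right Rplus 0 (map (fun p => snd p * mono (fst p) x) S).
(* S lists (al, c_al) for all al in gamma with c_al <> 0, so poly_of S = f_gamma *)
Definition gamma_part_list n (V : vec n -> Prop) f (g : vec n -> Prop) (S : list (mindex n * R)) : Prop :=
  NoDup (map fst S) /\
  (forall p, In p S -> taylor_coef V f (fst p) (snd p) /\ g (natv (fst p))) /\
  (forall al, g (natv al) -> in_supp V f al -> In al (map fst S)).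
Definition grad_nonzero n (h : vec n -> R) (J : 'I_n -> Prop) (x : vec n) : Prop :=
  ~ (forall j, J j -> has_partial h j x 0).
Definition nondegenerate n (U : vec n -> Prop) (f : vec n -> R) : Prop :=
  forall g, compact_face (Newton U f) g ->
  forall S, gamma_part_list U f g S ->
  forall x, U x -> (forall i, x i <> 0) -> grad_nonzero (poly_of S) (fun _ => True) x.

Definition lmin n (P : vec n -> Prop) (a : vec n) (m : R) : Prop :=
  (exists x, P x /\ dotR a x = m) /\ forall x, P x -> m <= dotR a x.
Definition dual_cone n (P g : vec n -> Prop) (a : vec n) : Prop :=
  (forall i, 0 <= a i) /\
  exists m, lmin P a m /\ forall x, (P x /\ dotR a x = m) <-> g x.
Definition in_cone n (S : list (mindex n)) (x : vec n) : Prop :=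
  exists lam : list R, length lam = length S /\ Forall (Rle 0) lam /\
    forall i, x i = fold_right Rplus 0 (map (fun p => fst p * INR (snd p i)) (combine lam S)).
Definition zlin n (B : list ('I_n -> Z)) (k : list Z) (i : 'I_n) : Z :=
  fold_right Z.add 0%Z (map (fun p => (fst p * snd p i)%Z) (combine k B)).
Definition Zbasis n (B : list ('I_n -> Z)) : Prop :=
  length B = n /\
  (forall z : 'I_n -> Z, exists k, length k = n /\ forall i, zlin B k i = z i) /\
  (forall k, length k = n -> (forall i, zlin B k i = 0%Z) -> Forall (eq 0%Z) k).
Definition completable n (S : list (mindex n)) : Prop :=
  exists T, Zbasis (map (@natZ n) S ++ T).
(* Sig: the cones of the subdivision, each given by its skeleton *)
Definition simplicial_subdivision n (P : vec n -> Prop) (Sig : list (mindex n) -> Prop) : Prop :=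
  (forall x, (forall i, 0 <= x i) <-> exists S, Sig S /\ in_cone S x) /\
  (forall S, Sig S -> exists g, is_face P g /\
       forall x, in_cone S x -> closure (dual_cone P g) x) /\
  (forall S, Sig S -> completable S).

Definition pi n (a : 'I_n -> mindex n) (y : vec n) : vec n :=
  fun k => \big[Rmult/1]_(j < n) (y j ^ a j k).
Definition T_I n (I : 'I_n -> bool) (y : vec n) : Prop := forall j, y j = 0 <-> I j.

(* Main.v *)
(**
Let [V] be the preimage of [U] under [pi a].  Approaching a wall [y_j = 0] of [V] amounts to
applying the one-parameter scaling of weight [a^j] to a point of [U], so the existence of the
part of [f] along the face defined by [(a^j, l_j)] bounds [f o pi] by a multiple of [y_j^(l_j)]
there, and Hadamard's lemma lets one divide by the coordinates one at a time; the quotients are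
smooth because [int_0^1 s^m h(.., s y_j, ..) ds] inherits the differentiability of [h].
The cone lies in the closure of one dual cone, so all the forms [a^j] are minimal at a common
support point [al0], which is the only lattice point where they are since the [a^j] form a basis.
For a set [I] of indices with [w = sum_(j in I) a^j] positive, comparing the Taylor expansion of
[f] along [t^w x] with the factorization shows that the face part cut out by [w], composed with
[pi a], equals [prod_j y_j^(l_j)] times [fs] restricted to [y_I = 0].  With [I] everything this
gives [fs 0 = c_al0 <> 0]; for the [I] of the theorem, a critical zero of the restriction of [fs]
would produce a critical point of the face part in the torus near [0].
*)
From Stdlib Require Import Reals ZArith List Lra FunctionalExtensionality Classical ClassicalEpsilon.
From HB Require Import structures.
From Coquelicot Require Import Coquelicot.
From mathcomp Require Import ssreflect ssrfun ssrbool eqtype ssrnat seq fintype bigop.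
Require Import Defs.
Set Implicit Arguments. Unset Strict Implicit. Unset Printing Implicit Defensive.
Open Scope R_scope.

(** * Real addition and multiplication as laws for big operators *)

HB.instance Definition _ := Monoid.isComLaw.Build R 0 Rplus
  (fun x y z => Logic.eq_sym (Rplus_assoc x y z)) Rplus_comm Rplus_0_l.
HB.instance Definition _ := Monoid.isComLaw.Build R 1 Rmult
  (fun x y z => Logic.eq_sym (Rmult_assoc x y z)) Rmult_comm Rmult_1_l.
HB.instance Definition _ := Monoid.isMulLaw.Build R 0 Rmult Rmult_0_l Rmult_0_r.
HB.instance Definition _ := Monoid.isAddLaw.Build R Rmult Rplus
  (fun x y z => Rmult_plus_distr_r x y z) Rmult_plus_distr_l.

(** * Continuity and [C^k] calculus on open sets *)

Section Calculus.
Variable n : nat.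
Implicit Types (x y z : vec n) (V W : vec n -> Prop) (f g h : vec n -> R) (i j : 'I_n).

Lemma updE x j t : upd x j t j = t.
Proof. by rewrite /upd eqxx. Qed.

Lemma upd_neq x j t i : i != j -> upd x j t i = x i.
Proof. by rewrite /upd => /negbTE ->. Qed.

Lemma upd_id x j : upd x j (x j) = x.
Proof. by apply: functional_extensionality => i; rewrite /upd; case: eqP => // ->. Qed.

Lemma upd_upd x j s t : upd (upd x j s) j t = upd x j t.
Proof. by apply: functional_extensionality => i; rewrite /upd; case: eqP. Qed.

Lemma upd_comm x i j s t : i != j -> upd (upd x i s) j t = upd (upd x j t) i s.
Proof.
move=> ij; apply: functional_extensionality => k; rewrite /upd.
case: eqP => [->|//]; by rewrite eq_sym (negbTE ij).
Qed.

Lemma near_refl x d : 0 < d -> near x x d.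
Proof. by move=> d0 i; rewrite Rminus_diag Rabs_R0. Qed.

Lemma near_le x y d e : d <= e -> near x y d -> near x y e.
Proof. by move=> de xy i; have := xy i; lra. Qed.

Lemma near_upd x j t d : 0 < d -> Rabs (t - x j) < d -> near x (upd x j t) d.
Proof.
move=> d0 td i; rewrite /upd; case: eqP => [->//|_].
by rewrite Rminus_diag Rabs_R0.
Qed.

Lemma near_upd2 x y j s t d :
  near x y d -> Rabs (t - s) < d -> near (upd x j s) (upd y j t) d.
Proof. by move=> xy st i; rewrite /upd; case: eqP. Qed.

Lemma near_updr x y j t d : near x y d -> Rabs (t - x j) < d -> near x (upd y j t) d.
Proof. by move=> xy td i; rewrite /upd; case: eqP => [->|]. Qed.

Lemma near_open x d : is_open (fun y => near x y d).
Proof.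
move=> y xy.
suff H : forall s : seq 'I_n, exists e, 0 < e /\ forall i, i \in s -> Rabs (y i - x i) + e <= d.
  have [e [e0 He]] := H (enum 'I_n); exists e; split=> // z yz i.
  have := He i; rewrite mem_enum => /(_ isT); have := yz i; split_Rabs; lra.
elim=> [|i s [e [e0 He]]]; first by exists 1; split; [lra|].
have xi := xy i.
exists (Rmin e (d - Rabs (y i - x i))); split; first by apply: Rmin_pos; lra.
move=> k; rewrite in_cons => /orP [/eqP ->|/He].
- have := Rmin_r e (d - Rabs (y i - x i)); lra.
- have := Rmin_l e (d - Rabs (y i - x i)); lra.
Qed.

Lemma open_and V W : is_open V -> is_open W -> is_open (fun x => V x /\ W x).
Proof.
move=> oV oW x [/oV [d [d0 Hd]] /oW [e [e0 He]]].
exists (Rmin d e); split; first exact: Rmin_pos.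
move=> y xy; split; [apply: Hd|apply: He]; apply: near_le xy.
- exact: Rmin_l. - exact: Rmin_r.
Qed.

Lemma open_upd V x j : is_open V -> V x ->
  exists d, 0 < d /\ forall t, Rabs (t - x j) < d -> V (upd x j t).
Proof.
move=> oV /oV [d [d0 Hd]]; exists d; split=> // t td; apply: Hd; exact: near_upd.
Qed.

Lemma cont_onP V f x : is_open V -> cont_on V f -> V x -> forall eps, 0 < eps ->
  exists d, 0 < d /\ forall y, near x y d -> V y /\ Rabs (f y - f x) < eps.
Proof.
move=> oV cf Vx eps e0.
have [d [d0 Hd]] := cf x Vx eps e0; have [e [e1 He]] := oV x Vx.
exists (Rmin d e); split; first exact: Rmin_pos.
move=> y xy.
have Vy : V y by apply: He; apply: near_le xy; exact: Rmin_r.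
by split=> //; apply: Hd => //; apply: near_le xy; exact: Rmin_l.
Qed.

Lemma cont_on_locally V f :
  (forall x, V x -> exists W, is_open W /\ W x /\ cont_on W f) -> cont_on V f.
Proof.
move=> H x Vx eps e0; have [W [oW [Wx cf]]] := H x Vx.
have [d [d0 Hd]] := cont_onP oW cf Wx e0.
by exists d; split=> // y _ /Hd [].
Qed.

Lemma cont_on_ext V f g : (forall x, V x -> f x = g x) -> cont_on V f -> cont_on V g.
Proof.
move=> fg cf x Vx eps e0; have [d [d0 Hd]] := cf x Vx eps e0.
exists d; split=> // y Vy xy; rewrite -!fg //; exact: Hd.
Qed.

Lemma cont_on_const V c : cont_on V (fun _ => c).
Proof.
by move=> x _ eps e0; exists 1; split; [lra|move=> y _ _; rewrite Rminus_diag Rabs_R0].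
Qed.

Lemma cont_on_coord V i : cont_on V (fun x => x i).
Proof. by move=> x _ eps e0; exists eps; split=> // y _; apply. Qed.

Lemma cont_on_plus V f g : cont_on V f -> cont_on V g -> cont_on V (fun x => f x + g x).
Proof.
move=> cf cg x Vx eps e0.
have e2 : 0 < eps / 2 by lra.
have [d [d0 Hd]] := cf x Vx _ e2; have [e [e1 He]] := cg x Vx _ e2.
exists (Rmin d e); split; first exact: Rmin_pos.
move=> y Vy xy.
have := Hd y Vy (near_le (Rmin_l _ _) xy); have := He y Vy (near_le (Rmin_r _ _) xy).
split_Rabs; lra.
Qed.

Lemma cont_on_comp1 V f (u : R -> R) :
  cont_on V f -> (forall x, V x -> continuity_pt u (f x)) -> cont_on V (fun x => u (f x)).
Proof.
move=> cf cu x Vx eps e0.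
have /continuity_pt_locally cu' := cu x Vx.
have [d Hd] := cu' (mkposreal _ e0).
have [e [e1 He]] := cf x Vx _ (cond_pos d).
exists e; split=> // y Vy xy; exact: (Hd _ (He y Vy xy)).
Qed.

(* Polarization reduces products to squares. *)
Lemma cont_on_mult V f g : cont_on V f -> cont_on V g -> cont_on V (fun x => f x * g x).
Proof.
move=> cf cg.
have csq h : cont_on V h -> cont_on V (fun x => h x * h x).
  move=> ch; apply: (cont_on_comp1 (u := fun t => t * t) ch) => x _.
  by apply: continuity_pt_mult; apply: continuity_pt_id.
have cneg h : cont_on V h -> cont_on V (fun x => - h x).
  move=> ch; apply: (cont_on_comp1 (u := fun t => - t) ch) => x _.
  by apply: continuity_pt_opp; apply: continuity_pt_id.
have chalf h : cont_on V h -> cont_on V (fun x => / 4 * h x).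
  move=> ch; apply: (cont_on_comp1 (u := fun t => / 4 * t) ch) => x _.
  by apply: continuity_pt_mult; [apply: continuity_pt_const|apply: continuity_pt_id].
apply: (@cont_on_ext _ (fun x => / 4 * ((f x + g x) * (f x + g x) +
                                 - ((f x + - g x) * (f x + - g x))))).
  by move=> x _; field.
apply: chalf; apply: cont_on_plus; first by apply: csq; apply: cont_on_plus.
by apply: (cneg); apply: csq; apply: cont_on_plus => //; apply: cneg.
Qed.

(** [Derive] is total, so this is a function everywhere, meaningful where [has_partial] holds. It
    serves as canonical choice for the derivative that [Ck] only asserts to exist. *)
Definition pd f j x : R := Derive (fun t => f (upd x j t)) (x j).

Lemma pdE f j x d : has_partial f j x d -> pd f j x = d.
Proof. by move/is_derive_Reals/is_derive_unique. Qed.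

Lemma has_partial_pd f j x d : has_partial f j x d -> has_partial f j x (pd f j x).
Proof. by move=> H; rewrite (pdE H). Qed.

Lemma has_partial_ext V f g j x d : is_open V -> V x -> (forall y, V y -> f y = g y) ->
  has_partial f j x d -> has_partial g j x d.
Proof.
move=> oV Vx fg /is_derive_Reals H; apply/is_derive_Reals.
apply: is_derive_ext_loc H; have [e [e0 He]] := open_upd j oV Vx.
by exists (mkposreal _ e0) => t /He Ht; apply: fg.
Qed.

Lemma is_derive_upd f j x t d :
  has_partial f j (upd x j t) d <-> is_derive (fun s => f (upd x j s)) t d.
Proof.
rewrite is_derive_Reals /has_partial updE.
suff -> : (fun s => f (upd (upd x j t) j s)) = (fun s => f (upd x j s)) by [].
by apply: functional_extensionality => s; rewrite upd_upd.
Qed.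

Lemma Ck_cont k V f : Ck k V f -> cont_on V f.
Proof. by case: k => [|k] //= []. Qed.

Lemma Ck_ext k V f g : is_open V -> (forall x, V x -> f x = g x) -> Ck k V f -> Ck k V g.
Proof.
move=> oV fg; case: k => [|k] /=; first exact: cont_on_ext.
case=> cf H; split; first exact: cont_on_ext cf.
move=> j; have [d [Hd Cd]] := H j; exists d; split=> // x Vx.
by apply: (has_partial_ext oV Vx fg); apply: Hd.
Qed.

Lemma Ck_succ k V f : is_open V ->
  Ck k.+1 V f <-> cont_on V f /\
    forall j, (forall x, V x -> has_partial f j x (pd f j x)) /\ Ck k V (pd f j).
Proof.
move=> oV; split=> -[cf H]; split=> // j.
- have [d [Hd Cd]] := H j; split=> [x /Hd /has_partial_pd //|].
  by apply: Ck_ext Cd => // x /Hd /pdE.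
- by exists (pd f j); exact: H.
Qed.

Lemma Ck_pred k V f : Ck k.+1 V f -> Ck k V f.
Proof.
elim: k f => [|k IH] f; first by case.
case=> cf H; split=> // j; have [d [Hd Cd]] := H j; exists d; split=> //; exact: IH.
Qed.

Lemma Ck_sub k V W f : (forall x, W x -> V x) -> Ck k V f -> Ck k W f.
Proof.
move=> WV; elim: k f => [|k IH] f /=.
  by move=> cf x Wx eps e0; have [d [d0 Hd]] := cf x (WV _ Wx) eps e0; exists d; split; auto.
case=> cf H; split.
  by move=> x Wx eps e0; have [d [d0 Hd]] := cf x (WV _ Wx) eps e0; exists d; split; auto.
by move=> j; have [d [Hd Cd]] := H j; exists d; split; auto.
Qed.

(** Used for quotients that are given by different formulas near a coordinate hyperplane and away
    from it. The canonical derivative [pd] makes the local pieces fit together. *)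
Lemma Ck_locally k V f : is_open V ->
  (forall x, V x -> exists W, is_open W /\ W x /\ Ck k W f) -> Ck k V f.
Proof.
move=> oV; elim: k f => [|k IH] f H; first exact: cont_on_locally H.
apply/Ck_succ => //; split.
  apply: cont_on_locally => x /H [W [oW [Wx [cf _]]]]; by exists W.
move=> j; split=> [x /H [W [oW [Wx /(Ck_succ _ _ oW) [_ Cf]]]]|].
  by have [Hd _] := Cf j; apply: Hd.
apply: IH => x /H [W [oW [Wx /(Ck_succ _ _ oW) [_ Cf]]]]; exists W; split=> //; split=> //.
by have [] := Cf j.
Qed.

Lemma Ck_const k V c : Ck k V (fun _ => c).
Proof.
elim: k c => [|k IH] c /=; first exact: cont_on_const.
split; first exact: cont_on_const.
by move=> j; exists (fun _ => 0); split=> // x _; apply: derivable_pt_lim_const.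
Qed.

Lemma Ck_coord k V i : Ck k V (fun x => x i).
Proof.
case: k => [|k] /=; first exact: cont_on_coord.
split; first exact: cont_on_coord.
move=> j; exists (fun _ => if i == j then 1 else 0); split; last exact: Ck_const.
move=> x _; rewrite /has_partial /upd; case: eqP => _.
- exact: derivable_pt_lim_id.
- exact: derivable_pt_lim_const.
Qed.

Lemma Ck_plus k V f g : Ck k V f -> Ck k V g -> Ck k V (fun x => f x + g x).
Proof.
elim: k f g => [|k IH] f g /=; first exact: cont_on_plus.
case=> cf Hf [cg Hg]; split; first exact: cont_on_plus.
move=> j; have [df [Hdf Cdf]] := Hf j; have [dg [Hdg Cdg]] := Hg j.
exists (fun x => df x + dg x); split; last exact: IH.
by move=> x Vx; apply: (derivable_pt_lim_plus _ _ _ _ _ (Hdf _ Vx) (Hdg _ Vx)).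
Qed.

Lemma Ck_mult k V f g : Ck k V f -> Ck k V g -> Ck k V (fun x => f x * g x).
Proof.
elim: k f g => [|k IH] f g; first exact: cont_on_mult.
move=> Cf Cg; have Cf' := Ck_pred Cf; have Cg' := Ck_pred Cg.
case: Cf => cf Hf; case: Cg => cg Hg; split; first exact: cont_on_mult.
move=> j; have [df [Hdf Cdf]] := Hf j; have [dg [Hdg Cdg]] := Hg j.
exists (fun x => df x * g x + f x * dg x); split; last by apply: Ck_plus; apply: IH.
move=> x Vx; have := derivable_pt_lim_mult _ _ _ _ _ (Hdf _ Vx) (Hdg _ Vx).
by rewrite upd_id.
Qed.

Lemma Ck_sum k V (I : Type) (s : seq I) (F : I -> vec n -> R) :
  (forall l : I, Ck k V (F l)) -> Ck k V (fun x => \big[Rplus/0]_(i <- s) F i x).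
Proof.
move=> CF; elim: s => [|i s IH].
- rewrite (_ : (fun x => _) = fun _ => 0); first exact: Ck_const.
  by apply: functional_extensionality => x; rewrite big_nil.
- rewrite (_ : (fun x => _) = fun x => F i x + \big[Rplus/0]_(i <- s) F i x).
    exact: Ck_plus.
  by apply: functional_extensionality => x; rewrite big_cons.
Qed.

Lemma Ck_prod k V (I : Type) (s : seq I) (F : I -> vec n -> R) :
  (forall l : I, Ck k V (F l)) -> Ck k V (fun x => \big[Rmult/1]_(i <- s) F i x).
Proof.
move=> CF; elim: s => [|i s IH].
- rewrite (_ : (fun x => _) = fun _ => 1); first exact: Ck_const.
  by apply: functional_extensionality => x; rewrite big_nil.
- rewrite (_ : (fun x => _) = fun x => F i x * \big[Rmult/1]_(i <- s) F i x).
    exact: Ck_mult.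
  by apply: functional_extensionality => x; rewrite big_cons.
Qed.

Lemma Ck_pow k V f m : Ck k V f -> Ck k V (fun x => f x ^ m).
Proof. by move=> Cf; elim: m => [|m IH] /=; [exact: Ck_const|exact: Ck_mult]. Qed.

(** The derivative is a constant multiple of the square of the function itself, so the induction on
    [k] closes through [Ck_mult]. *)
Lemma Ck_inv_coord k V j : (forall x, V x -> x j <> 0) -> Ck k V (fun x => / x j).
Proof.
move=> Vj; have ci : cont_on V (fun x => / x j).
  apply: (cont_on_comp1 (u := Rinv) (@cont_on_coord V j)) => x /Vj xj.
  by apply: continuity_pt_inv => //; apply: continuity_pt_id.
elim: k => [|k IH] //=; split=> // i.
exists (fun x => (if j == i then -1 else 0) * (/ x j * / x j)); split.
  move=> x /Vj xj; rewrite /has_partial /upd; case: eqP => [e|_].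
  - subst i; apply/is_derive_Reals; auto_derive=> //; field; auto.
  - rewrite Rmult_0_l; exact: derivable_pt_lim_const.
by apply: Ck_mult; [exact: Ck_const|exact: Ck_mult].
Qed.

Lemma smooth_pd V f j : is_open V -> smooth_on V f -> smooth_on V (pd f j).
Proof. by move=> oV sf k; have /(Ck_succ _ _ oV) [_ /(_ j) []] := sf k.+1. Qed.

Lemma smooth_partial V f j x : is_open V -> smooth_on V f -> V x ->
  has_partial f j x (pd f j x).
Proof. by move=> oV sf Vx; have /(Ck_succ _ _ oV) [_ /(_ j) [H _]] := sf 1%N; apply: H. Qed.

End Calculus.

(** * The chain rule and composition of [C^k] maps *)

Section ChainRule.
Variable n : nat.
Implicit Types (x y z : vec n) (U V W : vec n -> Prop) (f g h : vec n -> R) (i j : 'I_n).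

Lemma common_radius (Q : 'I_n -> R -> Prop) :
  (forall i, exists d, 0 < d /\ Q i d) ->
  (forall i d e, 0 < e -> e <= d -> Q i d -> Q i e) ->
  exists d, 0 < d /\ forall i, Q i d.
Proof.
move=> HQ mQ.
suff H : forall s : seq 'I_n, exists d, 0 < d /\ forall i, i \in s -> Q i d.
  have [d [d0 Hd]] := H (enum 'I_n); exists d; split=> // i; apply: Hd; exact: mem_enum.
elim=> [|i s [e [e0 He]]]; first by exists 1; split; [lra|].
have [d [d0 Hd]] := HQ i; have m0 := Rmin_pos _ _ e0 d0.
exists (Rmin e d); split=> // k; rewrite in_cons => /orP [/eqP ->|/He].
- apply: mQ Hd => //; exact: Rmin_r.
- apply: mQ => //; exact: Rmin_l.
Qed.

Lemma coord_MVT f j z t :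
  (forall c, Rmin (z j) t <= c <= Rmax (z j) t ->
     has_partial f j (upd z j c) (pd f j (upd z j c))) ->
  exists c, Rmin (z j) t <= c <= Rmax (z j) t /\
    f (upd z j t) - f z = pd f j (upd z j c) * (t - z j).
Proof.
move=> H.
have D c : Rmin (z j) t <= c <= Rmax (z j) t ->
    is_derive (fun s => f (upd z j s)) c (pd f j (upd z j c)).
  by move=> /H /is_derive_upd.
have [||c [Hc E]] := @MVT_gen (fun s => f (upd z j s)) (z j) t (fun c => pd f j (upd z j c)).
- by move=> c Hc; apply: D; lra.
- move=> c /D Hc; apply/continuity_pt_filterlim; apply: ex_derive_continuous.
  by eexists; exact: Hc.
by exists c; split=> //; rewrite -E upd_id.
Qed.

(** The difference quotient of [D] is [c] times that of [u], and [c] tends to [q]. The factor may be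
    chosen anew for each [t], which is the form in which the mean value theorem supplies it. *)
Lemma caratheodory (D u : R -> R) (t0 q d : R) :
  D t0 = 0 -> is_derive u t0 d ->
  (forall eps, 0 < eps -> exists del, 0 < del /\ forall t, Rabs (t - t0) < del ->
     exists c, Rabs (c - q) < eps /\ D t = c * (u t - u t0)) ->
  is_derive D t0 (q * d).
Proof.
move=> D0 /is_derive_Reals Hu H; apply/is_derive_Reals => eps e0.
set A := Rabs q + 1; set B := Rabs d + 1.
have A0 : 0 < A by rewrite /A; have := Rabs_pos q; lra.
have B0 : 0 < B by rewrite /B; have := Rabs_pos d; lra.
(* The 1 keeps the quotient [v] bounded by [B]; the other entry makes the second term of the
   splitting below smaller than [eps / 2]. *)
set e1 := Rmin 1 (eps / (2 * A)).
have e1p : 0 < e1.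
  by apply: Rmin_pos; [lra|]; apply: Rdiv_lt_0_compat; lra.
have e2p : 0 < eps / (2 * B) by apply: Rdiv_lt_0_compat; lra.
have [d1 Hd1] := Hu _ e1p; have [d2 [d2p Hd2]] := H _ e2p.
have mp : 0 < Rmin d1 d2 by apply: Rmin_pos => //; exact: cond_pos.
exists (mkposreal _ mp) => k k0 /= kd.
have h1 := Hd1 k k0 (Rlt_le_trans _ _ _ kd (Rmin_l _ _)).
have [|c [cq E]] := Hd2 (t0 + k).
  rewrite (_ : t0 + k - t0 = k); last ring.
  exact: Rlt_le_trans kd (Rmin_r _ _).
rewrite D0 Rminus_0_r E; set v := (u (t0 + k) - u t0) / k in h1 *.
rewrite (_ : c * _ / k = c * v); last by rewrite /v; field.
have h2 : Rabs (v - d) < 1 by have := Rmin_l 1 (eps / (2 * A)); rewrite -/e1; lra.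
have h3 : Rabs (v - d) < eps / (2 * A).
  by have := Rmin_r 1 (eps / (2 * A)); rewrite -/e1; lra.
have vB : Rabs v <= B by rewrite /B; move: h2; split_Rabs; lra.
clearbody v.
rewrite (_ : c * v - q * d = (c - q) * v + q * (v - d)); last ring.
apply: (Rle_lt_trans _ _ _ (Rabs_triang _ _)); rewrite !Rabs_mult.
have i1 : Rabs (c - q) * Rabs v <= eps / (2 * B) * B.
  by apply: Rmult_le_compat; try exact: Rabs_pos; lra.
have i2 : Rabs q * Rabs (v - d) <= Rabs q * (eps / (2 * A)).
  by apply: Rmult_le_compat_l; [exact: Rabs_pos|lra].
have i3 : Rabs q * (eps / (2 * A)) < A * (eps / (2 * A)).
  apply: Rmult_lt_compat_r; last by rewrite /A; lra.
  by apply: Rdiv_lt_0_compat; lra.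
rewrite (_ : eps / (2 * B) * B = eps / 2) in i1; last by field; lra.
rewrite (_ : A * (eps / (2 * A)) = eps / 2) in i3; last by field; lra.
lra.
Qed.

Lemma path_near (ga : R -> vec n) t0 (d : vec n) :
  (forall i, is_derive (fun t => ga t i) t0 (d i)) ->
  forall r, 0 < r -> exists del, 0 < del /\
    forall t, Rabs (t - t0) < del -> near (ga t0) (ga t) r.
Proof.
move=> H r r0.
have [i|i a b b0 ba Ha t tb|del [del0 Hd]] := @common_radius (fun i del =>
  forall t, Rabs (t - t0) < del -> Rabs (ga t i - ga t0 i) < r).
- have /continuity_pt_filterlim/continuity_pt_locally Hc :=
    ex_derive_continuous _ _ (ex_intro _ _ (H i)).
  have [del Hd] := Hc (mkposreal _ r0).
  by exists del; split; [exact: cond_pos|move=> t td; apply: Hd].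
- by apply: Ha; lra.
by exists del; split=> // t td i; apply: Hd.
Qed.

(* The coordinates are switched from [ga t0] to [ga t] one after the other, so
   that the mean value theorem in one variable applies to each increment. *)
Lemma chain_rule U f (ga : R -> vec n) t0 (d : vec n) :
  is_open U -> Ck 1 U f -> U (ga t0) ->
  (forall i, is_derive (fun t => ga t i) t0 (d i)) ->
  is_derive (fun t => f (ga t)) t0 (\big[Rplus/0]_(i < n) (pd f i (ga t0) * d i)).
Proof.
move=> oU /(Ck_succ _ _ oU) [cf Hf] U0 Hd.
pose z (s : seq 'I_n) t : vec n := fun i => if i \in s then ga t i else ga t0 i.
suff H : forall s, uniq s ->
    is_derive (fun t => f (z s t)) t0 (\big[Rplus/0]_(i <- s) (pd f i (ga t0) * d i)).
  have := H (index_enum 'I_n) (index_enum_uniq _).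
  suff -> : (fun t => f (z (index_enum 'I_n) t)) = fun t => f (ga t) by [].
  apply: functional_extensionality => t; congr f; apply: functional_extensionality => i.
  by rewrite /z mem_index_enum.
elim=> [_|j s IH /= /andP [js us]].
  rewrite big_nil; rewrite (_ : (fun t => _) = fun _ => f (ga t0)).
    exact: is_derive_const.
  by apply: functional_extensionality.
rewrite big_cons Rplus_comm.
rewrite (_ : (fun t => _) =
  fun t => f (z s t) + (f (upd (z s t) j (ga t j)) - f (z s t))); last first.
  apply: functional_extensionality => t.
  rewrite (_ : z (j :: s) t = upd (z s t) j (ga t j)); first ring.
  apply: functional_extensionality => i; rewrite /z /upd in_cons.
  by case: eqP => // ->.
apply: is_derive_plus; first exact: IH.
have zj t : z s t j = ga t0 j by rewrite /z (negbTE js).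
apply: (@caratheodory _ (fun t => ga t j)) => //.
  rewrite -(zj t0) upd_id; ring.
move=> eps e0; have [Pf Cf] := Hf j.
have [r [r0 Hr]] := cont_onP oU (Ck_cont Cf) U0 e0.
have [del [del0 Hdel]] := path_near Hd r0.
exists del; split=> // t /Hdel nt.
have nz : near (ga t0) (z s t) r.
  by move=> i; rewrite /z; case: ifP => _ //; rewrite Rminus_diag Rabs_R0.
have ntj := nt j.
have nc c : Rmin (z s t j) (ga t j) <= c <= Rmax (z s t j) (ga t j) ->
    near (ga t0) (upd (z s t) j c) r.
  rewrite zj => Hc; apply: near_updr => //; move: Hc ntj.
  rewrite /Rmin /Rmax; case: Rle_dec => _ Hc; split_Rabs; lra.
have [|c [Hc E]] := @coord_MVT f j (z s t) (ga t j).
  by move=> c /nc /Hr [Uc _]; apply: Pf.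
exists (pd f j (upd (z s t) j c)); split; first by have [] := Hr _ (nc _ Hc).
by rewrite E zj.
Qed.

End ChainRule.

(** By the chain rule each partial derivative is a sum of products of some [pd f i] composed with
    [phi] and a partial derivative of [phi]; the induction hypothesis applies to the former. *)
Lemma Ck_comp m n k (U : vec n -> Prop) (V : vec m -> Prop) f (phi : vec m -> vec n) :
  is_open U -> is_open V -> (forall y, V y -> U (phi y)) ->
  (forall i, Ck k V (fun y => phi y i)) -> Ck k U f -> Ck k V (fun y => f (phi y)).
Proof.
move=> oU oV VU.
have cc g : (forall i, cont_on V (fun y => phi y i)) -> cont_on U g ->
    cont_on V (fun y => g (phi y)).
  move=> cphi cg y Vy eps e0; have [d [d0 Hd]] := cg _ (VU _ Vy) _ e0.
  have [i|i a b b0 ba Ha z Vz yz|e [e1 He]] := @common_radius n (fun i e =>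
     forall z, V z -> near y z e -> Rabs (phi z i - phi y i) < d).
  - exact: cphi.
  - by apply: Ha => //; apply: near_le yz.
  by exists e; split=> // z Vz yz; apply: Hd; [exact: VU|move=> i; apply: He].
elim: k f => [|k IH] f Cphi Cf; first exact: cc.
have C1 : Ck 1 U f.
  move/(Ck_succ _ _ oU): Cf => [cf Hf]; apply/Ck_succ => //; split=> // j.
  by have [Pf /Ck_cont Cf] := Hf j.
have cphi i : cont_on V (fun y => phi y i) by exact: Ck_cont (Cphi i).
move/(Ck_succ _ _ oU): (Cf) => [cf Hf].
split; first exact: cc.
move=> j.
exists (fun y => \big[Rplus/0]_(i < n) (pd f i (phi y) * pd (fun y => phi y i) j y)).
split.
  move=> y Vy; apply/is_derive_Reals.
  have := @chain_rule n U f (fun t => phi (upd y j t)) (y j)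
    (fun i => pd (fun y => phi y i) j y) oU C1.
  rewrite upd_id; apply; first exact: VU.
  move=> i; move/(Ck_succ _ _ oV): (Cphi i) => [_ /(_ j) [Pp _]].
  by have /is_derive_Reals := Pp _ Vy.
apply: Ck_sum => i; apply: Ck_mult.
- by apply: IH => [l|]; [exact: Ck_pred (Cphi l)|have [_] := Hf i].
- by move/(Ck_succ _ _ oV): (Cphi i) => [_ /(_ j) [_]].
Qed.

(** * Weighted averages along one coordinate and Hadamard's lemma *)

Section Averages.
Variables (n : nat) (j : 'I_n) (p : vec n) (r : R).
Hypothesis pj : p j = 0.
Implicit Types (x y z : vec n) (h : vec n -> R) (i : 'I_n).

Let W y := near p y r.

Let oW : is_open W.
Proof. exact: near_open. Qed.

(** Differentiating in the direction [j] brings out one more factor [t]; carrying the power [t ^ m]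
    closes the family under partial derivatives. *)
Definition shrunk m h (t : R) y := t ^ m * h (upd y j (t * y j)).
Definition average m h y : R := RInt (fun t => shrunk m h t y) 0 1.

(** The box is centred on the hyperplane where coordinate [j] vanishes, so shrinking that coordinate
    does not leave it. *)
Lemma shrunk_in y t : W y -> 0 <= t <= 1 -> W (upd y j (t * y j)).
Proof.
move=> Wy t01; apply: near_updr => //; have := Wy j; rewrite pj !Rminus_0_r Rabs_mult.
rewrite (Rabs_right t); last lra.
have := Rabs_pos (y j); nra.
Qed.

Lemma mult_close (a b eps : R) : 0 < eps -> exists e, 0 < e /\
  forall a' b', Rabs (a' - a) < e -> Rabs (b' - b) < e -> Rabs (a' * b' - a * b) < eps.
Proof.
move=> e0; have c : continuity_2d_pt Rmult a b.
  by apply: continuity_2d_pt_mult; [apply: continuity_2d_pt_id1|apply: continuity_2d_pt_id2].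
have [d Hd] := c (mkposreal _ e0); exists d; split; first exact: cond_pos.
by move=> a' b' ha hb; apply: (Hd a' b').
Qed.

(** Joint continuity in parameter and point, required for continuity of the integral and for
    differentiation under it. Here [t'] may fall slightly outside the unit interval, so membership
    in [W] is part of the conclusion. *)
Lemma shrunk_close m h y t eps : cont_on W h -> W y -> 0 <= t <= 1 -> 0 < eps ->
  exists d, 0 < d /\ forall y' t', near y y' d -> Rabs (t' - t) < d ->
    W (upd y' j (t' * y' j)) /\ Rabs (shrunk m h t' y' - shrunk m h t y) < eps.
Proof.
move=> ch Wy t01 e0.
have [e [ep He]] := mult_close (t ^ m) (h (upd y j (t * y j))) e0.
have [d1 [d1p H1]] := cont_onP oW ch (shrunk_in Wy t01) ep.
have [d2 [d2p H2]] := mult_close t (y j) d1p.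
have /continuity_pt_locally H3 : continuity_pt (fun t => t ^ m) t.
  by apply: derivable_continuous_pt; apply: derivable_pt_pow.
have [d3 {}H3] := H3 (mkposreal _ ep).
have d3p := cond_pos d3.
exists (Rmin d1 (Rmin d2 d3)); split; first by do !apply: Rmin_pos.
move=> y' t' yy tt.
have m1 := Rmin_l d1 (Rmin d2 d3); have m2 := Rmin_r d1 (Rmin d2 d3).
have m3 := Rmin_l d2 d3; have m4 := Rmin_r d2 d3.
have n1 : near (upd y j (t * y j)) (upd y' j (t' * y' j)) d1.
  apply: near_upd2; first exact: near_le yy.
  by apply: H2; [lra|have := yy j; lra].
have [W1 h1] := H1 _ n1; split=> //.
by apply: He => //; apply: H3; change (Rabs (t' - t) < d3); lra.
Qed.

Lemma shrunk_continuous m h y t : cont_on W h -> W y -> 0 <= t <= 1 ->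
  continuous (fun t => shrunk m h t y) t.
Proof.
move=> ch Wy t01; apply/continuity_pt_filterlim/continuity_pt_locally => eps.
have [d [d0 Hd]] := shrunk_close m ch Wy t01 (cond_pos eps).
exists (mkposreal _ d0) => t' tt; exact: (proj2 (Hd y t' (near_refl _ d0) tt)).
Qed.

Lemma shrunk_ex_RInt m h y : cont_on W h -> W y -> ex_RInt (fun t => shrunk m h t y) 0 1.
Proof.
move=> ch Wy; apply: ex_RInt_continuous => t.
rewrite Rmin_left ?Rmax_right; try lra; move=> t01; exact: shrunk_continuous.
Qed.

Lemma shrunk_partial m h i t y :
  (forall x, W x -> has_partial h i x (pd h i x)) -> W (upd y j (t * y j)) ->
  has_partial (shrunk m h t) i y (shrunk (if i == j then m.+1 else m) (pd h i) t y).
Proof.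
move=> Ph Wt; apply/is_derive_Reals; rewrite /shrunk; have := Ph _ Wt.
case: eqP => [->|/eqP ij].
  move/is_derive_upd => H.
  apply: (@is_derive_ext _ _ (fun u => t ^ m * h (upd y j (t * u)))).
    by move=> u; rewrite upd_upd updE.
  rewrite (_ : t ^ m.+1 * _ = t ^ m * (t * pd h j (upd y j (t * y j)))); last by rewrite /=; ring.
  apply: is_derive_scal.
  apply: (@is_derive_comp _ _ (fun s => h (upd y j s)) (fun u => t * u)) => //.
  by auto_derive=> //; ring.
move/is_derive_Reals; rewrite upd_neq // => H.
apply: is_derive_scal; apply: is_derive_ext H => u.
by rewrite (upd_neq _ _ (i := j)) 1?eq_sym // upd_comm 1?eq_sym.
Qed.

(** Compactness of the unit interval turns the pointwise radii of [shrunk_close] into a single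
    radius valid for all [t]. *)
Lemma average_cont m h : cont_on W h -> cont_on W (average m h).
Proof.
move=> ch y Wy eps e0.
have e4 : 0 < eps / 4 by lra.
(* The compactness statement takes a gauge defined on all of the line; outside the unit interval the
   radius 1 is a dummy value. *)
have dex t : { d : posreal | 0 <= t <= 1 -> forall y' t', near y y' d -> Rabs (t' - t) < d ->
    Rabs (shrunk m h t' y' - shrunk m h t y) < eps / 4 }.
  apply: constructive_indefinite_description.
  have [t01|nt] := classic (0 <= t <= 1); last by exists (mkposreal _ Rlt_0_1).
  have [d [d0 Hd]] := shrunk_close m ch Wy t01 e4.
  by exists (mkposreal _ d0) => _ y' t' yy tt; have [] := Hd y' t' yy tt.
have [d Hd] := compactness_value_1d 0 1 (fun t => proj1_sig (dex t)).
exists d; split; first exact: cond_pos.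
move=> y' Wy' yy.
rewrite /average (_ : _ - _ = RInt (fun t => minus (shrunk m h t y') (shrunk m h t y)) 0 1);
  last by rewrite RInt_minus //; exact: shrunk_ex_RInt.
apply: (@Rle_lt_trans _ ((1 - 0) * (eps / 2))); last lra.
apply: abs_RInt_le_const; first lra.
  by apply: ex_RInt_minus; exact: shrunk_ex_RInt.
(* Both integrands at [s] are compared with the integrand at [y] and the nearby gauge point [t], at
   the cost of [eps / 4] each. *)
move=> s s01; have /NNPP [t [t01 [st dt]]] := Hd s s01.
have Ht := proj2_sig (dex t) t01.
have h1 := Ht y' s (near_le dt yy) st.
have h2 := Ht y s (near_refl _ (cond_pos _)) st.
rewrite /minus /plus /opp /=; move: h1 h2; split_Rabs; lra.
Qed.

Lemma average_partial m h i y : cont_on W h ->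
  (forall x, W x -> has_partial h i x (pd h i x)) -> cont_on W (pd h i) -> W y ->
  has_partial (average m h) i y (average (if i == j then m.+1 else m) (pd h i) y).
Proof.
move=> ch Ph cd Wy; set m' := if _ then _ else _.
have Rm : Rmin 0 1 = 0 by rewrite Rmin_left //; lra.
have RM : Rmax 0 1 = 1 by rewrite Rmax_right //; lra.
have D u t : W (upd (upd y i u) j (t * upd y i u j)) ->
    is_derive (fun v => shrunk m h t (upd y i v)) u (shrunk m' (pd h i) t (upd y i u)).
  by move=> Wu; apply/is_derive_upd; exact: shrunk_partial.
have [e [e0 He]] := open_upd i oW Wy.
apply/is_derive_Reals; rewrite /average.
(* Differentiation under the integral sign yields an integral of [Derive], which agrees with the
   explicit integrand inside the interval. *)
rewrite -(_ : RInt (fun t => Derive (fun u => shrunk m h t (upd y i u)) (y i)) 0 1 =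
  RInt (fun t => shrunk m' (pd h i) t y) 0 1); last first.
  apply: RInt_ext => t; rewrite Rm RM => t01; apply: is_derive_unique.
  rewrite -[X in shrunk _ _ _ X](upd_id y i); apply: D.
  by rewrite upd_id; apply: shrunk_in => //; lra.
apply: (@is_derive_RInt_param (fun u t => shrunk m h t (upd y i u))).
- exists (mkposreal _ e0) => u ue t; rewrite Rm RM => t01.
  by eexists; apply: D; apply: shrunk_in => //; apply: He.
- move=> t; rewrite Rm RM => t01 eps.
  have [d [d0 Hd]] := shrunk_close m' cd Wy t01 (cond_pos eps).
  exists (mkposreal _ d0) => u v /= hu hv.
  have [W1 h1] := Hd (upd y i u) v (near_upd d0 hu) hv.
  rewrite (is_derive_unique _ _ _ (D _ _ W1)).
  rewrite (is_derive_unique _ _ _ (D (y i) t _)) upd_id //.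
  exact: shrunk_in.
- exists (mkposreal _ e0) => u ue; apply: shrunk_ex_RInt => //; exact: He.
Qed.

Lemma average_Ck k m h : Ck k W h -> Ck k W (average m h).
Proof.
elim: k m h => [|k IH] m h Ch; first exact: average_cont.
move/(Ck_succ _ _ oW): (Ch) => [ch Hh]; split; first exact: average_cont.
move=> i; have [Ph Ci] := Hh i.
exists (average (if i == j then m.+1 else m) (pd h i)); split; last exact: IH.
by move=> y Wy; apply: average_partial => //; exact: Ck_cont Ci.
Qed.

(** The fundamental theorem of calculus along the segment on which coordinate [j] runs from 0 to
    [y j]. *)
Lemma hadamard h y : Ck 1 W h -> W y ->
  h y - h (upd y j 0) = y j * average 0 (pd h j) y.
Proof.
move=> /(Ck_succ _ _ oW) [ch /(_ j) [Ph cd]] Wy.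
have Rm : Rmin 0 1 = 0 by rewrite Rmin_left //; lra.
have RM : Rmax 0 1 = 1 by rewrite Rmax_right //; lra.
have H : is_RInt (fun t => y j * shrunk 0 (pd h j) t y) 0 1
    (minus (h (upd y j (1 * y j))) (h (upd y j (0 * y j)))).
  apply: (@is_RInt_derive _ (fun t => h (upd y j (t * y j)))) => t; rewrite Rm RM => t01.
    have /is_derive_upd := Ph _ (shrunk_in Wy t01); rewrite /shrunk /= Rmult_1_l => H.
    apply: (@is_derive_comp _ _ (fun s => h (upd y j s)) (fun t => t * y j)) => //.
    by auto_derive=> //; ring.
  apply: (@continuous_scal_r _ _ _ (y j) (fun t => shrunk 0 (pd h j) t y)).
  exact: shrunk_continuous.
move: H; rewrite Rmult_1_l Rmult_0_l upd_id => H.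
have H2 : is_RInt (fun t => y j * shrunk 0 (pd h j) t y) 0 1 (y j * average 0 (pd h j) y).
  apply: (@is_RInt_scal _ (fun t => shrunk 0 (pd h j) t y)).
  by apply: RInt_correct; apply: shrunk_ex_RInt.
by rewrite -(is_RInt_unique _ _ _ _ H2) (is_RInt_unique _ _ _ _ H).
Qed.

End Averages.

(** * Smooth division by one coordinate *)

Section Division.
Variable n : nat.
Implicit Types (x y z : vec n) (V W : vec n -> Prop) (f g h : vec n -> R) (i j : 'I_n).

Lemma smooth_div_coord V h j : is_open V -> smooth_on V h ->
  (forall y, V y -> y j = 0 -> h y = 0) ->
  exists g, smooth_on V g /\ forall y, V y -> h y = y j * g y.
Proof.
move=> oV sh h0.
(* The quotient is forced off the hyperplane and continued by the derivative on it. Near a point of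
   the hyperplane it coincides with [average j 0 (pd h j)], which is smooth. *)
pose g y := if Req_EM_T (y j) 0 then pd h j y else h y / y j.
exists g; split; last first.
  move=> y Vy; rewrite /g; case: Req_EM_T => [yj|yj] /=; last by field.
  by rewrite (h0 y) // yj; ring.
move=> k; apply: Ck_locally => // p Vp.
have [pj|pj] := Req_EM_T (p j) 0.
  have [r [r0 Hr]] := oV p Vp.
  have oW := near_open (x := p) (d := r).
  exists (fun y => near p y r); split=> //; split; first exact: near_refl.
  have Ch1 : Ck 1 (fun y => near p y r) h by apply: Ck_sub (sh 1%N).
  apply: (@Ck_ext _ _ _ (average j 0 (pd h j))) => //; last first.
    by apply: average_Ck => //; apply: Ck_sub (smooth_pd j oV sh k).
  move=> y Wy; rewrite /g; case: Req_EM_T => [yj|yj] /=.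
    rewrite /average (RInt_ext _ (fun _ => pd h j y)).
      by rewrite RInt_const /scal /= /mult /=; ring.
    by move=> t _; rewrite /shrunk yj Rmult_0_r -yj upd_id /=; ring.
  have := hadamard pj Ch1 Wy.
  rewrite (h0 (upd y j 0)) ?updE //; last first.
    apply: Hr; apply: near_updr => //; have := r0.
    by rewrite pj Rminus_diag Rabs_R0.
  by move=> E; apply: (Rmult_eq_reg_l (y j)) => //; rewrite -E; field.
(* A box of radius [Rabs (p j)] around [p] misses the hyperplane, so the quotient is a product with
   [/ y j] there. *)
exists (fun y => V y /\ near p y (Rabs (p j))).
have oW := open_and oV (near_open (x := p) (d := Rabs (p j))).
split=> //; split.
  by split=> //; apply: near_refl; apply: Rabs_pos_lt.
have yj y : V y /\ near p y (Rabs (p j)) -> y j <> 0.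
  by move=> [_ /(_ j)] H e; move: H; rewrite e; split_Rabs; lra.
apply: (@Ck_ext _ _ _ (fun y => h y * / y j)) => //.
  by move=> y /yj ny; rewrite /g; case: Req_EM_T.
apply: Ck_mult; first by apply: Ck_sub (sh k) => y [].
exact: Ck_inv_coord.
Qed.

End Division.

(** * Smooth division by a monomial *)

Section MultiDivision.
Variable n : nat.
Implicit Types (x y z : vec n) (V W : vec n -> Prop) (f g h : vec n -> R) (i j : 'I_n).

(* Only points off the other coordinate hyperplanes are tested: there the
   condition survives division by the other coordinates. *)
Definition vanishes V h j (l : nat) := forall y, V y -> y j = 0 ->
  (forall i, i != j -> y i <> 0) ->
  exists C d, 0 < d /\ forall t, 0 < t < d -> Rabs (h (upd y j t)) <= C * t ^ l.

(** Off the other hyperplanes the bound tends to 0 because the exponent is positive; such points are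
    dense in the wall, and continuity does the rest. *)
Lemma vanishes_zero V h j l : is_open V -> cont_on V h -> vanishes V h j l.+1 ->
  forall y, V y -> y j = 0 -> h y = 0.
Proof.
move=> oV ch vh.
have gen y : V y -> y j = 0 -> (forall i, i != j -> y i <> 0) -> h y = 0.
  move=> Vy yj yi; apply: NNPP => hy.
  have [C [d [d0 Hd]]] := vh y Vy yj yi.
  have e0 : 0 < Rabs (h y) / 2 by have := Rabs_pos_lt _ hy; lra.
  have [e [e1 He]] := cont_onP oV ch Vy e0.
  have C1 : 0 < Rabs C + 1 by have := Rabs_pos C; lra.
  have q0 : 0 < Rabs (h y) / 2 / (Rabs C + 1) by apply: Rdiv_lt_0_compat.
  (* For this [t] the value of [h] has moved by less than half of [Rabs (h y)], while the assumed
     bound is at most that half. *)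
  pose t := Rmin (Rmin (d / 2) (e / 2)) (Rmin 1 (Rabs (h y) / 2 / (Rabs C + 1))).
  have t0 : 0 < t by do !apply: Rmin_pos; lra.
  have t1 : t <= d / 2 by apply: Rle_trans (Rmin_l _ _) (Rmin_l _ _).
  have t2 : t <= e / 2 by apply: Rle_trans (Rmin_l _ _) (Rmin_r _ _).
  have t3 : t <= 1 by apply: Rle_trans (Rmin_r _ _) (Rmin_l _ _).
  have t4 : t <= Rabs (h y) / 2 / (Rabs C + 1) by apply: Rle_trans (Rmin_r _ _) (Rmin_r _ _).
  have [|_ h1] := He (upd y j t).
    by apply: near_upd => //; rewrite yj Rminus_0_r Rabs_right; lra.
  have h2 : Rabs (h (upd y j t)) <= C * t ^ l.+1 by apply: Hd; lra.
  have h3 : t ^ l <= 1 by rewrite -(pow1 l); apply: pow_incr; lra.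
  have h4 : 0 <= t ^ l by apply: pow_le; lra.
  have h5 : C * t ^ l.+1 <= (Rabs C + 1) * t.
    rewrite /=; apply: (Rle_trans _ ((Rabs C + 1) * (t * t ^ l))).
      by apply: Rmult_le_compat_r; [nra|have := Rle_abs C; lra].
    by apply: Rmult_le_compat_l; nra.
  have h6 : (Rabs C + 1) * t <= Rabs (h y) / 2.
    have := Rmult_le_compat_l _ _ _ (Rlt_le _ _ C1) t4.
    by rewrite (_ : _ * (_ / _ / _) = Rabs (h y) / 2) //; field; lra.
  move: h1 h2 h5 h6; split_Rabs; lra.
(* For a general point of the wall, the other zero coordinates are moved to [e / 2]; [h] vanishes at
   the new point, yet differs there from [h y] by less than [Rabs (h y)]. *)
move=> y Vy yj; apply: NNPP => hy.
have [e [e1 He]] := cont_onP oV ch Vy (Rabs_pos_lt _ hy).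
pose y' : vec n := fun i => if i == j then 0 else
  if Req_EM_T (y i) 0 then e / 2 else y i.
have [|Vy' h1] := He y'.
  move=> i; rewrite /y'; case: eqP => [->|_]; first by rewrite yj Rminus_diag Rabs_R0.
  by case: Req_EM_T => [yi|yi] /=; rewrite ?yi ?Rminus_0_r ?Rminus_diag ?Rabs_R0 // Rabs_right; lra.
have h2 : h y' = 0.
  apply: gen => //; first by rewrite /y' eqxx.
  by move=> i /negbTE ij; rewrite /y' ij; case: Req_EM_T => //= _; lra.
by move: h1; rewrite h2; split_Rabs; lra.
Qed.

(** The list holds each index as often as its coordinate is to be divided out. One division lowers
    the order along its own wall by one and preserves the order along the other walls. *)
Lemma smooth_div_seq (js : seq 'I_n) V h : is_open V -> smooth_on V h ->
  (forall j, vanishes V h j (count_mem j js)) ->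
  exists g, smooth_on V g /\ forall y, V y -> h y = (\big[Rmult/1]_(j <- js) y j) * g y.
Proof.
move=> oV; elim: js h => [|j js IH] h sh vh.
  by exists h; split=> // y _; rewrite big_nil Rmult_1_l.
have [|g [sg Eg]] := smooth_div_coord (j := j) oV sh.
  apply: (@vanishes_zero _ _ _ (count_mem j js)) => //; first exact: (sh 0%N).
  by have := vh j; rewrite /= eqxx.
have [k|q [sq Eq]] := IH g sg; last first.
  by exists q; split=> // y Vy; rewrite big_cons Eg // Eq // Rmult_assoc.
move=> y Vy yk yi; have [C [d [d0 Hd]]] := vh k y Vy yk yi.
have [e [e0 He]] := open_upd k oV Vy; rewrite yk in He.
have [kj|/eqP kj] := @eqP _ k j.
  subst k; exists C, (Rmin d e); split; first exact: Rmin_pos.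
  move=> t [t0 td]; have m1 := Rmin_l d e; have m2 := Rmin_r d e.
  have := Hd t; rewrite Eg; last by apply: He; rewrite Rminus_0_r Rabs_right; lra.
  rewrite updE /= eqxx add1n /= Rabs_mult (Rabs_right t); last lra.
  move=> H; apply: (Rmult_le_reg_l t) => //.
  by have := H (conj t0 (Rlt_le_trans _ _ _ td m1)); lra.
(* Along another wall the divisor is the fixed nonzero number [y j], which only changes the
   constant. *)
have yj : y j <> 0 by apply: yi; rewrite eq_sym.
have yj0 := Rabs_pos_lt _ yj.
exists (C / Rabs (y j)), (Rmin d e); split; first exact: Rmin_pos.
move=> t [t0 td]; have m1 := Rmin_l d e; have m2 := Rmin_r d e.
have := Hd t; rewrite Eg; last by apply: He; rewrite Rminus_0_r Rabs_right; lra.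
rewrite upd_neq 1?eq_sym // /= (eq_sym j) (negbTE kj) add0n Rabs_mult => H.
apply: (Rmult_le_reg_l (Rabs (y j))) => //.
have E T : Rabs (y j) * (C / Rabs (y j) * T) = C * T by field; lra.
by rewrite E; apply: H; lra.
Qed.

End MultiDivision.

(** * Taylor expansion in one coordinate *)

Section Taylor.
Variable n : nat.
Implicit Types (x y z : vec n) (V W : vec n -> Prop) (f g h : vec n -> R) (i j : 'I_n).

Definition pdn k j f := iter k (fun g => pd g j) f.

Lemma smooth_pdn V f j k : is_open V -> smooth_on V f -> smooth_on V (pdn k j f).
Proof. by move=> oV sf; elim: k => [|k IH] //=; apply: smooth_pd. Qed.

Lemma is_derive_bigsum (T : Type) (s : seq T) (F : T -> R -> R) (D : T -> R) t :
  (forall k, is_derive (F k) t (D k)) ->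
  is_derive (fun u => \big[Rplus/0]_(k <- s) F k u) t (\big[Rplus/0]_(k <- s) D k).
Proof.
move=> H; elim: s => [|k s IH].
  rewrite big_nil; apply: (@is_derive_ext _ _ (fun _ => 0)); last exact: is_derive_const.
  by move=> u; rewrite big_nil.
rewrite big_cons; apply: (@is_derive_ext _ _ (fun u => F k u + \big[Rplus/0]_(k <- s) F k u)).
  by move=> u; rewrite big_cons.
exact: is_derive_plus.
Qed.

(* The remainder of order [N.+1] of [f] has the remainder of order [N] of
   [pd f j] as its derivative and vanishes at [0]. *)
Lemma taylor_coord V f j N : is_open V -> V (zero n) -> smooth_on V f ->
  exists C d, 0 < d /\ 0 <= C /\ forall x, near (zero n) x d ->
    Rabs (f x - \big[Rplus/0]_(k < N) (x j ^ k / INR (fact k) * pdn k j f (upd x j 0)))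
      <= C * Rabs (x j) ^ N.
Proof.
move=> oV V0; elim: N f => [|N IH] f sf.
  have [d [d0 Hd]] := cont_onP oV (sf 0%N) V0 Rlt_0_1.
  exists (Rabs (f (zero n)) + 1), d; split=> //.
  split; first by have := Rabs_pos (f (zero n)); lra.
  by move=> x /Hd [_]; rewrite big_ord0 /=; split_Rabs; lra.
have [C [d [d0 [C0 Hd]]]] := IH _ (smooth_pd j oV sf).
have [e [e0 He]] := oV _ V0.
exists C, (Rmin d e); split; first exact: Rmin_pos.
split=> // x nx.
pose A k := pdn k j f (upd x j 0).
pose F s := f (upd x j s) - \big[Rplus/0]_(k < N.+1) (s ^ k / INR (fact k) * A k).
pose dF s := pd f j (upd x j s) - \big[Rplus/0]_(k < N) (s ^ k / INR (fact k) * A k.+1).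
have xj : Rabs (x j) < Rmin d e by have := nx j; rewrite /zero Rminus_0_r.
have inside c : Rmin 0 (x j) <= c <= Rmax 0 (x j) -> Rabs c <= Rabs (x j).
  by rewrite /Rmin /Rmax; case: Rle_dec => _ Hc; split_Rabs; lra.
have nc c : Rmin 0 (x j) <= c <= Rmax 0 (x j) -> near (zero n) (upd x j c) (Rmin d e).
  move=> /inside Hc; apply: near_updr => //; rewrite /zero Rminus_0_r; lra.
have DF c : Rmin 0 (x j) <= c <= Rmax 0 (x j) -> is_derive F c (dF c).
  move=> /nc Hc; apply: (@is_derive_minus _ _ (fun s => f (upd x j s))).
    apply/is_derive_upd; apply: smooth_partial => //; first exact: oV.
    by apply: He; apply: near_le Hc; exact: Rmin_r.
  (* The term of index 0 is constant in [s]; splitting it off shifts the index so that term [k.+1]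
     differentiates to term [k] of [dF]. *)
  apply: (@is_derive_ext _ _ (fun s => A 0%N + \big[Rplus/0]_(k < N)
     (s ^ k.+1 / INR (fact k.+1) * A k.+1))).
    by move=> s; rewrite big_ord_recl /= /bump /=; field_simplify (1 / 1 * A 0%N).
  rewrite -[X in is_derive _ _ X]Rplus_0_l; apply: is_derive_plus.
    exact: is_derive_const.
  apply: is_derive_bigsum => k.
  have p1 := INR_fact_neq_0 k; have p2 := pos_INR k.
  have fS : INR (fact k.+1) = (INR k + 1) * INR (fact k).
    by rewrite fact_simpl mult_INR S_INR.
  rewrite (_ : c ^ k / _ * _ = A k.+1 / INR (fact k.+1) * (INR k.+1 * c ^ k)); last first.
    by rewrite fS S_INR; field; split=> //; lra.
  have E s : A k.+1 / INR (fact k.+1) * s ^ k.+1 = s ^ k.+1 / INR (fact k.+1) * A k.+1.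
    by rewrite /Rdiv; ring.
  apply: (is_derive_ext _ _ _ _ E).
  by apply: is_derive_scal; apply/is_derive_Reals; exact: derivable_pt_lim_pow.
have [||c [Hc E]] := @MVT_gen F 0 (x j) dF.
- by move=> c Hc; apply: DF; lra.
- move=> c /DF Hc; apply/continuity_pt_filterlim; apply: ex_derive_continuous.
  by eexists; exact: Hc.
have F0 : F 0 = 0.
  rewrite /F big_ord_recl big1; last by move=> k _; rewrite /= /bump /=; rewrite /Rdiv; ring.
  by rewrite /A /=; field.
have Fx : F (x j) = f x - \big[Rplus/0]_(k < N.+1)
    (x j ^ k / INR (fact k) * pdn k j f (upd x j 0)) by rewrite /F upd_id.
rewrite -Fx; move: E; rewrite F0 !Rminus_0_r => ->.
rewrite Rabs_mult /= (Rmult_comm (Rabs (x j))) -Rmult_assoc.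
apply: Rmult_le_compat_r; first exact: Rabs_pos.
have := Hd (upd x j c) (near_le (Rmin_l _ _) (nc _ Hc)).
rewrite updE (eq_bigr (fun k : 'I_N => c ^ k / INR (fact k) * A k.+1)); last first.
  by move=> k _; rewrite upd_upd /A /pdn iterSr.
move=> H; apply: Rle_trans H _; apply: Rmult_le_compat_l => //.
by apply: pow_incr; split; [exact: Rabs_pos|exact: inside].
Qed.

End Taylor.

(** * Taylor expansion in all coordinates and uniqueness of coefficients *)

Section MultiTaylor.
Variable n : nat.
Implicit Types (x y z : vec n) (V W : vec n -> Prop) (f g h : vec n -> R) (i j : 'I_n).
Implicit Types (al : mindex n) (S : list (mindex n * R)) (s : seq 'I_n).

Definition updm al j (k : nat) : mindex n := fun i => if i == j then k else al i.

Lemma poly_ofE S x : poly_of S x = \big[Rplus/0]_(p <- S) (snd p * mono (fst p) x).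
Proof.
by rewrite /poly_of; elim: S => [|p S IH] /=; rewrite ?big_nil ?big_cons ?IH.
Qed.

Lemma mono_updm al j k x : al j = 0%N ->
  mono (updm al j k) x = x j ^ k * mono al (upd x j 0).
Proof.
move=> aj; rewrite /mono (bigD1 j) //= [in RHS](bigD1 j) //= aj /updm eqxx Rmult_1_l.
congr Rmult; apply: eq_bigr => i /negbTE ij; by rewrite /upd ij.
Qed.

Lemma fact_m_updm al j k : al j = 0%N ->
  fact_m (updm al j k) = INR (fact k) * fact_m al.
Proof.
move=> aj; rewrite /fact_m (bigD1 j) //= [in RHS](bigD1 j) //= aj /updm eqxx Rmult_1_l.
by congr Rmult; apply: eq_bigr => i /negbTE ->.
Qed.

Lemma fact_m_neq0 al : fact_m al <> 0.
Proof.
rewrite /fact_m; elim/big_ind: _ => [|a b a0 b0|i _]; first exact: R1_neq_R0.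
- exact: Rmult_integral_contrapositive_currified.
- exact: INR_fact_neq_0.
Qed.

Lemma iter_partial_nseq V f h j k js : is_open V -> smooth_on V f ->
  iter_partial V js (pdn k j f) h -> iter_partial V (nseq k j ++ js) f h.
Proof.
move=> oV; elim: k f => [|k IH] f sf //; rewrite /pdn iterSr => H /=.
apply: (ip_cons (g := pd f j)); first by move=> x Vx; exact: smooth_partial oV sf Vx.
by apply: IH => //; exact: smooth_pd.
Qed.

(** A Taylor coefficient whose derivatives follow the order of [s]; for [s] equal to [enum 'I_n] it
    is [taylor_coef]. *)
Definition ordered_coef V f s al c :=
  exists h, iter_partial V (flatten [seq nseq (al i) i | i <- s]) f h /\
            c = h (zero n) / fact_m al.

Lemma ordered_coef_cons V f j s al c k : is_open V -> smooth_on V f ->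
  j \notin s -> al j = 0%N -> ordered_coef V (pdn k j f) s al c ->
  ordered_coef V f (j :: s) (updm al j k) (c / INR (fact k)).
Proof.
move=> oV sf js aj [h [Hh ->]]; exists h; split; last first.
  rewrite fact_m_updm //; field; split; [exact: fact_m_neq0|exact: INR_fact_neq_0].
rewrite /= {1}/updm eqxx; apply: iter_partial_nseq => //.
rewrite (_ : [seq nseq (updm al j k i) i | i <- s] = [seq nseq (al i) i | i <- s]) //.
apply/eq_in_map => i is_; rewrite /updm; case: eqP => // e.
by move: js; rewrite -e is_.
Qed.

Lemma near0_upd x j d : 0 < d -> near (zero n) x d -> near (zero n) (upd x j 0) d.
Proof. by move=> d0 nx; apply: near_updr => //; rewrite /zero Rminus_0_r Rabs_R0. Qed.

Lemma sum_pow_upd x j N :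
  \big[Rplus/0]_(i < n) Rabs (upd x j 0 i) ^ N <= \big[Rplus/0]_(i < n) Rabs (x i) ^ N.
Proof.
elim/big_ind2: _ => [|a b c d|i _]; [lra|lra|].
apply: pow_incr; split; first exact: Rabs_pos.
rewrite /upd; case: eqP => _; last lra.
by rewrite Rabs_R0; exact: Rabs_pos.
Qed.

Lemma sum_pow_ge0 x N : 0 <= \big[Rplus/0]_(i < n) Rabs (x i) ^ N.
Proof.
by elim/big_ind: _ => [|a b|i _]; [lra|lra|apply: pow_le; exact: Rabs_pos].
Qed.

Lemma sum_pow_ge x j N : Rabs (x j) ^ N <= \big[Rplus/0]_(i < n) Rabs (x i) ^ N.
Proof.
rewrite (bigD1 j) //= -[X in X <= _]Rplus_0_r; apply: Rplus_le_compat_l.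
by elim/big_ind: _ => [|a b|i _]; [lra|lra|apply: pow_le; exact: Rabs_pos].
Qed.

(* Expanding one coordinate after the other produces the partial derivatives in
   the order of [mlist], so no symmetry of mixed derivatives is needed. *)
Lemma taylor_seq s N V f : uniq s -> is_open V -> V (zero n) -> smooth_on V f ->
  exists S C d, 0 < d /\ 0 <= C /\ NoDup (map fst S) /\
    (forall p, In p S -> (forall i, i \notin s -> fst p i = 0%N) /\
                         ordered_coef V f s (fst p) (snd p)) /\
    (forall al, (forall i, i \notin s -> al i = 0%N) -> (forall i, (al i < N)%N) ->
       In al (map fst S)) /\
    (forall x, near (zero n) x d -> (forall i, i \notin s -> x i = 0) ->
       Rabs (f x - poly_of S x) <= C * \big[Rplus/0]_(i < n) Rabs (x i) ^ N).
Proof.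
move=> + oV V0; elim: s f => [|j s IH] f.
  move=> _ sf; exists [:: ((fun _ => 0%N) : mindex n, f (zero n))], 0, 1.
  split; first lra; split; first lra; split.
    by apply: NoDup_cons => //; exact: NoDup_nil.
  split; first move=> p /= [<-|//].
    split=> //=; exists f; split; first exact: ip_nil.
    rewrite /fact_m big1 /=; first by field.
    by move=> i _.
  split; first by move=> al al0 _; left; apply: functional_extensionality => i; rewrite al0.
  move=> x _ x0; rewrite (_ : x = zero n); last first.
    by apply: functional_extensionality => i; rewrite x0.
  rewrite /poly_of /= /mono big1 //= Rmult_1_r Rplus_0_r Rminus_diag Rabs_R0; lra.
move=> /= /andP [js us] sf.
pose E x := \big[Rplus/0]_(i < n) Rabs (x i) ^ N.
pose covered M al := (forall i, i \notin j :: s -> al i = 0%N) /\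
                     (forall i, (al i < N)%N) /\ (al j < M)%N.
(* Induction on the number [M] of terms in the expansion along [j] whose coefficients have
   themselves been expanded. The bound on the exponent of [j] keeps monomials from different stages
   distinct. *)
suff H : forall M, exists S C d, 0 < d /\ 0 <= C /\ NoDup (map fst S) /\
    (forall p, In p S -> ((forall i, i \notin j :: s -> fst p i = 0%N) /\
                 ordered_coef V f (j :: s) (fst p) (snd p)) /\ (fst p j < M)%N) /\
    (forall al, covered M al -> In al (map fst S)) /\
    (forall x, near (zero n) x d -> (forall i, i \notin j :: s -> x i = 0) ->
       Rabs (\big[Rplus/0]_(k < M) (x j ^ k / INR (fact k) * pdn k j f (upd x j 0))
             - poly_of S x) <= C * E x).
  have [S [C [d [d0 [C0 [ndS [SP [Scov Sb]]]]]]]] := H N.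
  have [C' [d' [d'0 [C'0 Hb]]]] := taylor_coord j N oV V0 sf.
  exists S, (C' + C), (Rmin d' d); split; first exact: Rmin_pos.
  split; first lra; split=> //; split; first by move=> p /SP [].
  split; first by move=> al al0 alN; apply: Scov.
  move=> x nx x0.
  have h1 := Hb x (near_le (Rmin_l _ _) nx).
  have h2 := Sb x (near_le (Rmin_r _ _) nx) x0.
  have h3 : C' * Rabs (x j) ^ N <= C' * E x.
    by apply: Rmult_le_compat_l => //; exact: sum_pow_ge.
  rewrite -/(E x) Rmult_plus_distr_r; move: h1 h2 h3.
  set T := \big[Rplus/0]_(k < N) _.
  by have := Rabs_triang (f x - T) (T - poly_of S x); rewrite (_ : _ + _ = f x - poly_of S x);
    [lra|ring].
elim=> [|M [S [C [d [d0 [C0 [ndS [SP [Scov Sb]]]]]]]]].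
  exists [::], 0, 1; split; first lra; split; first lra; split; first exact: NoDup_nil.
  split=> //; split; first by move=> al [_ []].
  by move=> x _ _; rewrite big_ord0 /poly_of /= Rminus_diag Rabs_R0; lra.
have [S1 [C1 [d1 [d10 [C10 [ndS1 [S1P [S1cov S1b]]]]]]]] :=
  IH _ us (smooth_pdn j M oV sf).
have S1j p : In p S1 -> fst p j = 0%N by move=> /S1P [H _]; exact: H.
pose S2 := [seq (updm (fst p) j M, snd p / INR (fact M)) | p <- S1].
have In2 p : In p S2 -> exists q, In q S1 /\ p = (updm (fst q) j M, snd q / INR (fact M)).
  by move=> /in_map_iff [q [<- ?]]; exists q.
exists (S ++ S2), (C + C1), (Rmin (Rmin d d1) 1).
split; first by do !apply: Rmin_pos => //; lra.
split; first lra; split.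
  rewrite map_cat; apply: NoDup_app => //; last first.
    move=> al /in_map_iff [p [<- /SP [_ pM]]] /in_map_iff [q [e /In2 [q1 [_ eq1]]]].
    by move: pM; rewrite -e eq1 /= /updm eqxx ltnn.
  rewrite /S2 -map_comp.
  have : forall p, In p S1 -> fst p j = 0%N by [].
  elim: S1 ndS1 {S1P S1cov S1b S1j S2 In2} => [|p S1 IH1] /= nd0 H1; first exact: NoDup_nil.
  move/NoDup_cons_iff: nd0 => [np nd1]; apply: NoDup_cons; last first.
    by apply: IH1 => // q Hq; apply: H1; right.
  move=> /in_map_iff [q [e Hq]]; apply: np; apply/in_map_iff; exists q; split=> //.
  apply: functional_extensionality => i.
  have := f_equal (fun a : mindex n => a i) e; rewrite /= /updm; case: eqP => [->|//] _.
  by rewrite !H1; auto.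
split.
  move=> p /in_app_iff [/SP [H pM]|/In2 [q [/[dup] /S1j qj /S1P [q0 qc] ->]]].
    by split=> //; exact: ltnW.
  split; last by rewrite /= /updm eqxx.
  split; last exact: ordered_coef_cons.
  by move=> i; rewrite in_cons negb_or /= /updm => /andP [/negbTE -> is_]; apply: q0.
split.
  move=> al [al0 [alN]]; rewrite ltnS leq_eqVlt => /orP [/eqP ajM|ajM]; rewrite map_cat;
    apply/in_app_iff; last by left; apply: Scov.
  right; rewrite /S2 -map_comp.
  have /in_map_iff [q [eq Hq]] : In (updm al j 0) (map fst S1).
    apply: S1cov => i; rewrite /updm; case: eqP => [_|/eqP ij] //.
    - by move=> is_; apply: al0; rewrite in_cons negb_or ij.
    - exact: leq_ltn_trans (leq0n _) (alN i).
  apply/in_map_iff; exists q; split=> //=; rewrite eq.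
  by apply: functional_extensionality => i; rewrite /updm; case: eqP => // ->.
move=> x nx x0; rewrite big_ord_recr /=.
have nx1 : near (zero n) x (Rmin d d1) := near_le (Rmin_l _ _) nx.
have h1 := Sb x (near_le (Rmin_l _ _) nx1) x0.
have h2 := S1b (upd x j 0) (near0_upd j d10 (near_le (Rmin_r _ _) nx1)).
have {}h2 : Rabs (pdn M j f (upd x j 0) - poly_of S1 (upd x j 0)) <= C1 * E x.
  apply: Rle_trans (h2 _) _; last by apply: Rmult_le_compat_l => //; exact: sum_pow_upd.
  move=> i is_; rewrite /upd; case: eqP => // /eqP ij.
  by apply: x0; rewrite in_cons negb_or ij.
have pS : poly_of (S ++ S2) x =
    poly_of S x + x j ^ M / INR (fact M) * poly_of S1 (upd x j 0).
  rewrite !poly_ofE big_cat /=; congr Rplus; rewrite big_map big_distrr /=.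
  elim: S1 S1j {S1P S1cov S1b S2 In2 ndS1 h2} => [|p S1 IH1] S1j; first by rewrite !big_nil.
  rewrite !big_cons IH1; last by move=> q Hq; apply: S1j; right.
  by congr Rplus; rewrite mono_updm; [rewrite /Rdiv; ring|apply: S1j; left].
rewrite pS; set T := \big[Rplus/0]_(k < M) _ in h1 *.
set c := x j ^ M / INR (fact M); set A := pdn _ _ _ _ in h2 *; set B := poly_of S1 _ in h2 *.
(* The radius was capped at 1 so that the factor in front of the new remainder is at most 1 and the
   constant [C1] is kept. *)
have c1 : Rabs c <= 1.
  rewrite /c /Rdiv Rabs_mult -RPow_abs.
  have xj : Rabs (x j) <= 1.
    by have := near_le (Rmin_r _ _) nx j; rewrite /zero Rminus_0_r; lra.
  have f1 : 1 <= INR (fact M) by rewrite -[1]/(INR 1); apply: le_INR; exact: lt_O_fact.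
  rewrite (Rabs_right (/ _)); last by apply: Rle_ge; apply/Rlt_le/Rinv_0_lt_compat; lra.
  have : Rabs (x j) ^ M <= 1 by rewrite -(pow1 M); apply: pow_incr; split=> //; exact: Rabs_pos.
  have : / INR (fact M) <= 1 by rewrite -Rinv_1; apply: Rinv_le_contravar; lra.
  have : 0 < / INR (fact M) by apply: Rinv_0_lt_compat; lra.
  have := pow_le (Rabs (x j)) M (Rabs_pos _); nra.
have h3 : Rabs (c * (A - B)) <= C1 * E x.
  rewrite Rabs_mult; have := Rabs_pos (A - B); have := Rabs_pos c; nra.
have := Rabs_triang (T - poly_of S x) (c * (A - B)).
rewrite (_ : _ + c * (A - B) = T + c * A - (poly_of S x + c * B)); last ring.
rewrite Rmult_plus_distr_r; lra.
Qed.

Lemma taylor_expansion N V f : is_open V -> V (zero n) -> smooth_on V f ->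
  exists S C d, 0 < d /\ 0 <= C /\ NoDup (map fst S) /\
    (forall p, In p S -> taylor_coef V f (fst p) (snd p)) /\
    (forall al, (forall i, (al i < N)%N) -> In al (map fst S)) /\
    (forall x, near (zero n) x d ->
       Rabs (f x - poly_of S x) <= C * \big[Rplus/0]_(i < n) Rabs (x i) ^ N).
Proof.
move=> oV V0 sf.
have [S [C [d [d0 [C0 [nd [SP [Sc Sb]]]]]]]] := taylor_seq N (enum_uniq 'I_n) oV V0 sf.
have all i : i \notin enum 'I_n -> False by rewrite mem_enum.
exists S, C, d; split=> //; split=> //; split=> //; split; first by move=> p /SP [].
split; first by move=> al; apply: Sc => i /all.
by move=> x nx; apply: Sb => // i /all.
Qed.

(** The functions in [iter_partial] are determined only on [V]. As [V] is open, agreement on [V]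
    passes to partial derivatives, and the coefficient is read off at a point of [V]. *)
Lemma taylor_coef_unique V f al c c' : is_open V -> V (zero n) ->
  taylor_coef V f al c -> taylor_coef V f al c' -> c = c'.
Proof.
move=> oV V0 [h [Hh ->]] [h' [Hh' ->]]; congr Rdiv.
suff H : forall js f h, iter_partial V js f h -> forall f' h', iter_partial V js f' h' ->
    (forall x, V x -> f x = f' x) -> forall x, V x -> h x = h' x.
  by apply: (H _ _ _ Hh _ _ Hh').
move=> {f h h' Hh Hh'} js f h; elim=> {js f h} [f|j js f g h Hg _ IH] f' h' H' ff.
  by inversion H'; subst.
inversion H' as [|j' js' f1 g' h1 Hg' Hh']; subst.
apply: IH Hh' _ => x Vx.
by rewrite -(pdE (Hg x Vx)); apply: pdE; apply: (has_partial_ext oV Vx _ (Hg' x Vx)) => y /ff.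
Qed.

End MultiTaylor.

(** * Minima on the Newton polyhedron, dual cones and unimodular skeletons *)

Section Polyhedra.
Variable n : nat.
Implicit Types (x y z b : vec n) (V U P g : vec n -> Prop) (f : vec n -> R) (i j : 'I_n).
Implicit Types (al w : mindex n).

Definition dotn (w al : mindex n) : nat := (\sum_(k < n) w k * al k)%N.

Lemma fold_right_bigE (T : Type) (F : T -> R) (s : seq T) :
  fold_right Rplus 0 (map F s) = \big[Rplus/0]_(q <- s) F q.
Proof. by elim: s => [|q s IH] /=; rewrite ?big_nil ?big_cons ?IH. Qed.

Lemma dotR_natv w al : dotR (natv w) (natv al) = INR (dotn w al).
Proof.
rewrite /dotR /dotn (big_morph INR (id1 := 0) (op1 := Rplus) plus_INR) //.
by apply: eq_bigr => k _; rewrite /natv -mult_INR.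
Qed.

Lemma Zv_natZ w : Zv (natZ w) = natv w.
Proof. by apply: functional_extensionality => i; rewrite /Zv /natZ -INR_IZR_INZ. Qed.

Lemma supp_Newton V f al : in_supp V f al -> Newton V f (natv al).
Proof.
move=> sal; exists [:: (1, al, natv al)]; split.
  by move=> q /= [<-|//] /=; split; [lra|split=> // i; exact: Rle_refl].
by split=> [|i] /=; rewrite /natv; ring.
Qed.

Lemma Newton_ge0 V f x i : Newton V f x -> 0 <= x i.
Proof.
move=> [l [Hl [_ ->]]]; elim: l Hl => [|q l IH] Hl /=; first lra.
have [q0 [_ qi]] := Hl q (or_introl erefl).
apply: Rplus_le_le_0_compat; last by apply: IH => q' hq; apply: Hl; right.
exact: Rmult_le_pos q0 (Rle_trans _ _ _ (pos_INR (snd (fst q) i)) (qi i)).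
Qed.

Lemma dotR_ler b x y : (forall i, 0 <= b i) -> (forall i, x i <= y i) -> dotR b x <= dotR b y.
Proof.
move=> b0 xy; rewrite /dotR; elim/big_ind2: _ => [|u v u' v'|i _]; [lra|lra|].
exact: Rmult_le_compat_l.
Qed.

(** Otherwise the form exceeds [m] at every support point, hence on every orthant attached to one
    since [b] is nonnegative, and a convex combination of values above [m] cannot equal [m]. *)
Lemma Newton_min_supp V f b m : (forall i, 0 <= b i) -> lmin (Newton V f) b m ->
  exists al, in_supp V f al /\ dotR b (natv al) = m.
Proof.
move=> b0 [[x [[l [Hl [l1 xE]]]] xm] mP]; apply: NNPP => nal.
have lt q : In q l -> m < dotR b (snd q).
  move=> /Hl [_ [sq qi]].
  have h1 := mP _ (supp_Newton sq).
  have h2 : dotR b (natv (snd (fst q))) <= dotR b (snd q) by apply: dotR_ler.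
  have h3 : dotR b (natv (snd (fst q))) <> m by move=> e; apply: nal; exists (snd (fst q)).
  lra.
have E : dotR b x = \big[Rplus/0]_(q <- l) (fst (fst q) * dotR b (snd q)).
  rewrite /dotR (eq_bigr (fun i => \big[Rplus/0]_(q <- l) (b i * (fst (fst q) * snd q i)))).
    rewrite exchange_big /=; apply: eq_bigr => q _; rewrite big_distrr /=.
    by apply: eq_bigr => i _; ring.
  by move=> i _; rewrite xE fold_right_bigE big_distrr.
rewrite fold_right_bigE in l1.
(* In the induction the total weight of a sublist may be zero, so strictness is claimed only for
   positive total weight. *)
suff [h1 h2] : m * \big[Rplus/0]_(q <- l) fst (fst q) <=
      \big[Rplus/0]_(q <- l) (fst (fst q) * dotR b (snd q)) /\
    (0 < \big[Rplus/0]_(q <- l) fst (fst q) -> m * \big[Rplus/0]_(q <- l) fst (fst q) <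
      \big[Rplus/0]_(q <- l) (fst (fst q) * dotR b (snd q))).
  by have := h2; rewrite l1 -E xm; lra.
elim: l Hl lt {l1 xE E} => [|q l IH] Hl lt; first by rewrite !big_nil; lra.
have [q0 _] := Hl q (or_introl erefl); have q1 := lt q (or_introl erefl).
have [h1 h2] := IH (fun q hq => Hl q (or_intror hq)) (fun q hq => lt q (or_intror hq)).
rewrite !big_cons; split; first nra.
by case: q0 => [q0|<-]; [nra|rewrite Rplus_0_l => /h2; lra].
Qed.

Lemma dual_cone_le P g b x y : dual_cone P g b -> g x -> P y -> dotR b x <= dotR b y.
Proof. by move=> [b0 [m [[_ mP] H]]] /H [_ ->] /mP. Qed.

(** For fixed [x] and [y] the inequality is a closed condition on [b]. *)
Lemma closure_dual_cone_le P g b x y :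
  closure (dual_cone P g) b -> g x -> P y -> dotR b x <= dotR b y.
Proof.
move=> cb gx Py; apply: Rnot_lt_le => lt.
have cd : cont_on (fun _ => True) (fun b => dotR b x + -1 * dotR b y).
  have c1 z : cont_on (fun _ => True) (fun b => dotR b z).
    apply: (Ck_sum (k := 0)) => i; apply: Ck_mult; [exact: Ck_coord|exact: Ck_const].
  apply: cont_on_plus => //; apply: cont_on_mult => //; exact: cont_on_const.
have e0 : 0 < dotR b x - dotR b y by lra.
have [d [d0 Hd]] := cd b I _ e0; have [b' [Cb' nb']] := cb d d0.
have := Hd b' I nb'; have := dual_cone_le Cb' gx Py; split_Rabs; lra.
Qed.

Lemma combine_map (T A B : Type) (u : T -> A) (v : T -> B) (s : seq T) :
  combine (map u s) (map v s) = [seq (u q, v q) | q <- s].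
Proof. by elim: s => [|i s IH] //=; rewrite IH. Qed.

Lemma big_indicator (F : 'I_n -> R) j :
  \big[Rplus/0]_(i < n) ((if i == j then 1 else 0) * F i) = F j.
Proof.
rewrite (bigD1 j) //= eqxx big1 ?Rmult_1_l ?Rplus_0_r // => i /negbTE ->.
by rewrite Rmult_0_l.
Qed.

Lemma skeleton_in_cone (a : 'I_n -> mindex n) j :
  in_cone (map a (enum 'I_n)) (natv (a j)).
Proof.
exists [seq (if i == j then 1 else 0) | i <- enum 'I_n]; split.
  by rewrite !length_map.
split.
  by apply/Forall_forall => t /in_map_iff [i [<- _]]; case: eqP => _; lra.
move=> k; rewrite combine_map -map_comp fold_right_bigE big_enum /=.
by rewrite (big_indicator (fun i => INR (a i k))).
Qed.

(** The [n] edge vectors are already a basis of the integer lattice, so a form vanishing on all of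
    them vanishes on the unit vectors. *)
Lemma skeleton_separates (a : 'I_n -> mindex n) (c : vec n) :
  completable (map a (enum 'I_n)) ->
  (forall j, dotR (natv (a j)) c = 0) -> forall k, c k = 0.
Proof.
move=> [T [szB [span _]]] H k.
(* The skeleton has [n] members and so does the completed basis, which leaves nothing to add. *)
have T0 : T = nil.
  apply: size0nil; move: szB; rewrite -[length _]/(size _) size_cat 2!size_map size_enum_ord.
  by move=> e; apply/eqP; rewrite -(eqn_add2l n) e addn0.
subst T; have [ks [_ Hk]] := span (fun i => if i == k then 1%Z else 0%Z).
have HB (q : 'I_n -> Z) :
    In q (map (@natZ n) (map a (enum 'I_n)) ++ [::]) -> dotR (Zv q) c = 0.
  by rewrite cats0 -map_comp => /in_map_iff [j [<- _]]; rewrite /= Zv_natZ.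
move: Hk HB; set B := _ ++ _; move=> Hk HB.
have zl : dotR (Zv (fun i => zlin B ks i)) c = 0.
  elim: B ks HB {Hk szB span} => [|b B IH] [|q ks] HB; rewrite /dotR /Zv.
  1-3: by apply: big1 => i _; rewrite /zlin /= Rmult_0_l.
  rewrite (eq_bigr (fun i => IZR q * (Zv b i * c i) + Zv (fun i => zlin B ks i) i * c i)).
    rewrite big_split /= -big_distrr /= -!/(dotR _ _) IH; last by move=> b' hb; apply: HB; right.
    by rewrite HB; [ring|left].
  by move=> i _; rewrite /Zv /zlin /= plus_IZR mult_IZR; ring.
rewrite -(big_indicator c k) -[RHS]zl; apply: eq_bigr => i _.
by rewrite /Zv Hk; case: eqP.
Qed.

End Polyhedra.

(** * Expansion of a function along a weighted scaling *)

Section FaceParts.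
Variable n : nat.
Implicit Types (x y z : vec n) (U V : vec n -> Prop) (f : vec n -> R) (i j k : 'I_n).
Implicit Types (al w : mindex n) (S : list (mindex n * R)).

Lemma pow_sum (I : Type) (s : seq I) (Q : pred I) (e : I -> nat) t :
  \big[Rmult/1]_(i <- s | Q i) t ^ e i = t ^ (\sum_(i <- s | Q i) e i)%N.
Proof. by rewrite (big_morph (pow t) (id1 := 1) (op1 := Rmult) (pow_add t)). Qed.

Lemma mono_tpow w al t x : mono al (tpow w t x) = t ^ dotn w al * mono al x.
Proof.
rewrite /mono /tpow /dotn -pow_sum -big_split /=; apply: eq_bigr => i _.
by rewrite Rpow_mult_distr -pow_mult.
Qed.

Lemma prod_neq0 (F : 'I_n -> R) : (forall i, F i <> 0) -> \big[Rmult/1]_(i < n) F i <> 0.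
Proof.
move=> F0; elim/big_ind: _ => [|a b|i _].
- exact: R1_neq_R0.
- exact: Rmult_integral_contrapositive_currified.
- exact: F0.
Qed.

Lemma pow_dec t (p q : nat) : 0 < t <= 1 -> (p <= q)%N -> t ^ q <= t ^ p.
Proof.
move=> t01 pq; rewrite -(subnKC pq) pow_add -[X in _ <= X]Rmult_1_r.
have := pow_le t p; have : t ^ (q - p) <= 1 by rewrite -(pow1 (q - p)); apply: pow_incr; lra.
move=> h1 h2; apply: Rmult_le_compat_l => //; apply: h2; lra.
Qed.

Lemma NoDup_map_filter (T T' : Type) (F : T -> T') (q : pred T) (s : seq T) :
  NoDup (map F s) -> NoDup (map F (filter q s)).
Proof.
elim: s => [|p s IH] //= /NoDup_cons_iff [np /IH nd]; case: (q p) => //=.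
apply: NoDup_cons => //; move=> /in_map_iff [p' [e /filter_In [hp _]]]; apply: np.
by apply/in_map_iff; exists p'.
Qed.

Definition face U f w (l : nat) x := Newton U f x /\ dotR (natv w) x = INR l.

Lemma coord_le_dotn w al i : (forall i, (0 < w i)%N) -> (al i <= dotn w al)%N.
Proof.
move=> w0; rewrite /dotn (bigD1 i) //=; apply: leq_trans (leq_addr _ _).
exact: leq_pmull.
Qed.

Lemma tpow_small w x d : 0 < d -> (forall i, (0 < w i)%N) ->
  exists e, 0 < e /\ e <= 1 /\ forall t, 0 < t < e -> near (zero n) (tpow w t x) d.
Proof.
move=> d0 w0; set M := \big[Rplus/0]_(i < n) Rabs (x i) ^ 1.
have M0 : 0 <= M by exact: sum_pow_ge0.
exists (Rmin 1 (d / (M + 1))); split.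
  by apply: Rmin_pos; [lra|apply: Rdiv_lt_0_compat; lra].
split; first exact: Rmin_l.
move=> t [t0 te] i.
have t1 : t < 1 by apply: Rlt_le_trans te (Rmin_l _ _).
have t2 : t < d / (M + 1) by apply: Rlt_le_trans te (Rmin_r _ _).
rewrite /zero Rminus_0_r /tpow Rabs_mult (Rabs_right (t ^ _)); last first.
  by apply/Rle_ge/pow_le; lra.
have h1 : t ^ w i <= t by rewrite -[X in _ <= X]pow_1; apply: pow_dec => //; lra.
have h2 : Rabs (x i) <= M by have := sum_pow_ge x i 1; rewrite pow_1.
have h3 : t * (M + 1) < d.
  have := Rmult_lt_compat_r (M + 1) _ _ _ t2; rewrite (_ : d / _ * _ = d); last by field; lra.
  by apply; lra.
have h4 := pow_le t (w i) (Rlt_le _ _ t0); have h5 := Rabs_pos (x i); nra.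
Qed.

(** In the Taylor polynomial, monomials on the face scale exactly by [t ^ l] and the others with
    nonzero coefficient by at least [t ^ l.+1]. As all weights are positive, the Taylor remainder
    also has order [l.+1] in [t]. *)
Lemma face_expansion U f w (l : nat) : is_open U -> U (zero n) -> smooth_on U f ->
  (forall i, (0 < w i)%N) -> (forall al, in_supp U f al -> (l <= dotn w al)%N) ->
  exists S, gamma_part_list U f (face U f w l) S /\
    forall x, exists K d, 0 < d /\ forall t, 0 < t < d -> U (tpow w t x) /\
      Rabs (f (tpow w t x) - t ^ l * poly_of S x) <= K * t ^ l.+1.
Proof.
move=> oU U0 sf w0 wl.
have [S0 [C [d [d0 [C0 [nd [SP [Sc Sb]]]]]]]] := taylor_expansion l.+1 oU U0 sf.
pose q (p : mindex n * R) : bool :=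
  if excluded_middle_informative (face U f w l (natv (fst p))) then true else false.
have qP p : reflect (face U f w l (natv (fst p))) (q p).
  by rewrite /q; case: excluded_middle_informative => H /=; constructor.
exists (filter q S0); split.
  split; first exact: NoDup_map_filter.
  split; first by move=> p /filter_In [/SP tp /qP gp].
  move=> al gal sal.
  (* Positive weights bound every entry of an exponent on the face by [l], so the expansion of order
     [l.+1] in each variable contains it. *)
  have /in_map_iff [p [ep hp]] : In al (map fst S0).
    apply: Sc => i; rewrite ltnS; apply: leq_trans (coord_le_dotn al i w0) _.
    by case: gal => _; rewrite dotR_natv => /INR_eq ->.
  by apply/in_map_iff; exists p; split=> //; apply/filter_In; split=> //; apply/qP; rewrite ep.
move=> x.
have [e [e0 He]] := oU _ U0.
have [r [r0 [r1 Hr]]] := tpow_small x (Rmin_pos _ _ d0 e0) w0.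
set B := \big[Rplus/0]_(i < n) Rabs (x i) ^ l.+1.
set A := \big[Rplus/0]_(p <- S0) Rabs (snd p * mono (fst p) x).
exists (C * B + A), r; split=> // t tr; have nt := Hr t tr.
have t01 : 0 < t <= 1 by lra.
split; first by apply: He; apply: near_le nt; exact: Rmin_r.
have h1 := Sb _ (near_le (Rmin_l _ _) nt).
have h2 : \big[Rplus/0]_(i < n) Rabs (tpow w t x i) ^ l.+1 <= t ^ l.+1 * B.
  rewrite /B big_distrr /=; elim/big_ind2: _ => [|u v u' v'|i _]; [lra|lra|].
  rewrite -[t * t ^ l]/(t ^ l.+1) -[_ * _ ^ l in X in X <= _]/(_ ^ l.+1).
  rewrite -[Rabs (x i) * _]/(_ ^ l.+1) -Rpow_mult_distr.
  apply: pow_incr; split; first exact: Rabs_pos.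
  rewrite /tpow Rabs_mult (Rabs_right (t ^ _)); last by apply/Rle_ge/pow_le; lra.
  apply: Rmult_le_compat_r; first exact: Rabs_pos.
  by rewrite -[X in _ <= X]pow_1; apply: pow_dec.
have h3 : Rabs (poly_of S0 (tpow w t x) - t ^ l * poly_of (filter q S0) x) <= A * t ^ l.+1.
  rewrite !poly_ofE /A.
  elim: (S0) SP {Sb Sc nd A h1} => [|p S IH] SP.
    by rewrite /= !big_nil Rmult_0_r Rminus_diag Rabs_R0 Rmult_0_l; lra.
  have {}IH := IH (fun p hp => SP p (or_intror hp)); have tp := SP p (or_introl erefl).
  have hp : Rabs (snd p * mono (fst p) (tpow w t x) -
      (if q p then t ^ l * (snd p * mono (fst p) x) else 0))
      <= Rabs (snd p * mono (fst p) x) * t ^ l.+1.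
    have rhs0 : 0 <= Rabs (snd p * mono (fst p) x) * t ^ l.+1.
      by apply: Rmult_le_pos; [exact: Rabs_pos|apply: pow_le; lra].
    rewrite mono_tpow; case: qP => [[_]|ng].
      rewrite dotR_natv => /INR_eq ->; rewrite (_ : _ - _ = 0); last ring.
      by rewrite Rabs_R0.
    rewrite Rminus_0_r.
    (* The list may contain zero coefficients, whose exponents need not satisfy the weight bound. *)
    have [->|c0] := Req_EM_T (snd p) 0; first by rewrite !Rmult_0_l Rabs_R0; lra.
    have sp : in_supp U f (fst p) by exists (snd p).
    have ll : (l < dotn w (fst p))%N.
      rewrite ltn_neqAle wl // andbT; apply/eqP => el; apply: ng; split.
        exact: supp_Newton.
      by rewrite dotR_natv el.
    rewrite (_ : snd p * _ = (snd p * mono (fst p) x) * t ^ dotn w (fst p)); last ring.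
    rewrite Rabs_mult (Rabs_right (t ^ _)); last by apply/Rle_ge/pow_le; lra.
    by apply: Rmult_le_compat_l; [exact: Rabs_pos|apply: pow_dec].
  rewrite /= !big_cons.
  set T1 := \big[Rplus/0]_(p <- S) (snd p * mono (fst p) (tpow w t x)) in IH *.
  have := Rabs_triang (snd p * mono (fst p) (tpow w t x) -
      (if q p then t ^ l * (snd p * mono (fst p) x) else 0))
    (T1 - t ^ l * \big[Rplus/0]_(p <- filter q S) (snd p * mono (fst p) x)).
  rewrite -[t * t ^ l]/(t ^ l.+1) Rmult_plus_distr_r => tri.
  apply: Rle_trans _ (Rplus_le_compat _ _ _ _ hp IH); apply: Rle_trans _ tri.
  apply: Req_le; congr Rabs; case: (q p) => /=; rewrite ?big_cons; ring.
have := Rabs_triang (f (tpow w t x) - poly_of S0 (tpow w t x))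
  (poly_of S0 (tpow w t x) - t ^ l * poly_of (filter q S0) x).
rewrite (_ : _ + (_ - _) = f (tpow w t x) - t ^ l * poly_of (filter q S0) x); last ring.
have h4 := Rmult_le_compat_l _ _ _ C0 h2.
move=> h5.
have : (C * B + A) * t ^ l.+1 = C * (t ^ l.+1 * B) + A * t ^ l.+1 by ring.
lra.
Qed.

End FaceParts.

(** * The monomial map, its scalings and the order along each wall *)

Section Monomial.
Variables (n : nat) (a : 'I_n -> mindex n).
Implicit Types (x y z : vec n) (U V : vec n -> Prop) (f fs : vec n -> R) (i j k : 'I_n).
Implicit Types (al w : mindex n) (S : list (mindex n * R)) (I : 'I_n -> bool).

Definition scale I (t : R) z : vec n := fun j => if I j then t * z j else z j.

Lemma prod_scale I (e : 'I_n -> nat) t z :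
  \big[Rmult/1]_(j < n) scale I t z j ^ e j =
  t ^ (\sum_(j < n | I j) e j)%N * \big[Rmult/1]_(j < n) z j ^ e j.
Proof.
rewrite -pow_sum [in RHS]big_mkcond -big_split /=; apply: eq_bigr => j _.
by rewrite /scale; case: (I j); rewrite ?Rpow_mult_distr // Rmult_1_l.
Qed.

Definition weight I : mindex n := fun k => (\sum_(j < n | I j) a j k)%N.

(** Scaling the coordinates in [I] upstairs is the weighted scaling by the sum of the corresponding
    edge vectors downstairs. *)
Lemma pi_scale I t z : pi a (scale I t z) = tpow (weight I) t (pi a z).
Proof.
by apply: functional_extensionality => k; rewrite /pi /tpow (prod_scale _ (a^~ k)).
Qed.

Lemma scale_pred1 j t z : scale (pred1 j) t z = upd z j (t * z j).
Proof.
by apply: functional_extensionality => i; rewrite /scale /upd /=; case: eqP => // ->.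
Qed.

Lemma pi_upd j t s z : pi a (upd z j (t * s)) = tpow (a j) t (pi a (upd z j s)).
Proof.
have := pi_scale (pred1 j) t (upd z j s); rewrite scale_pred1 updE upd_upd => ->.
congr tpow; apply: functional_extensionality => k; exact: big_pred1_eq.
Qed.

Lemma tpow0 w x : (forall i, (0 < w i)%N) -> tpow w 0 x = zero n.
Proof.
move=> w0; apply: functional_extensionality => k; rewrite /tpow pow_i ?Rmult_0_l //.
exact/ltP.
Qed.

Lemma Ck_pi p V k : Ck p V (fun y => pi a y k).
Proof. by apply: Ck_prod => j; apply: Ck_pow; exact: Ck_coord. Qed.

Lemma Ck_poly p V S : Ck p V (poly_of S).
Proof.
rewrite (_ : poly_of S = fun x => \big[Rplus/0]_(q <- S) (snd q * mono (fst q) x)).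
  apply: Ck_sum => q; apply: Ck_mult; first exact: Ck_const.
  by apply: Ck_prod => j; apply: Ck_pow; exact: Ck_coord.
by apply: functional_extensionality => x; exact: poly_ofE.
Qed.

Lemma open_full m : is_open (fun _ : vec m => True).
Proof. by move=> x _; exists 1; split; [lra|]. Qed.

Lemma open_pi U : is_open U -> is_open (fun y => U (pi a y)).
Proof.
move=> oU y Uy; have [d [d0 Hd]] := oU _ Uy.
have [k|k e e' e'0 ee He z nz|e [e0 He]] := @common_radius n (fun k e =>
    forall z, near y z e -> Rabs (pi a z k - pi a y k) < d).
- have cp : cont_on (fun _ => True) (fun y => pi a y k) by exact: (Ck_pi 0).
  have [e [e0 He]] := cp y I d d0.
  by exists e; split=> // z; exact: (He z I).
- by apply: He; apply: near_le nz.
by exists e; split=> // z nz; apply: Hd => k; exact: He.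
Qed.

Lemma dotR_weight I x :
  dotR (natv (weight I)) x = \big[Rplus/0]_(j < n | I j) dotR (natv (a j)) x.
Proof.
rewrite /dotR exchange_big /=; apply: eq_bigr => k _.
rewrite /natv /weight (big_morph INR (id1 := 0) (op1 := Rplus) plus_INR) //.
by rewrite big_distrl.
Qed.

(** Along [scale I t z] the factorization and the face expansion both carry [t ^ l]; dividing by it
    and letting [t] tend to 0 gives the identity. *)
Lemma face_factor U f fs lv I S :
  is_open U -> U (zero n) -> cont_on (fun y => U (pi a y)) fs ->
  (forall y, U (pi a y) -> f (pi a y) = (\big[Rmult/1]_(j < n) (y j ^ lv j)) * fs y) ->
  (forall k, (0 < weight I k)%N) ->
  (forall x, exists K d, 0 < d /\ forall t, 0 < t < d -> U (tpow (weight I) t x) /\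
      Rabs (f (tpow (weight I) t x) - t ^ (\sum_(j < n | I j) lv j)%N * poly_of S x)
        <= K * t ^ (\sum_(j < n | I j) lv j).+1) ->
  forall z, poly_of S (pi a z) = (\big[Rmult/1]_(j < n) (z j ^ lv j)) * fs (scale I 0 z).
Proof.
move=> oU U0 cfs fac w0 HS z.
have [K [d [d0 Hd]]] := HS (pi a z).
set X := poly_of S _ in Hd *; set Q := \big[Rmult/1]_(j < n) _.
set l := (\sum_(j < n | I j) lv j)%N in Hd.
apply: NNPP => ne.
set e := Rabs (X - Q * fs (scale I 0 z)).
have e0 : 0 < e by apply: Rabs_pos_lt; lra.
(* With positive weights the limit point is sent to the origin, hence into the domain, for every
   [z]. *)
have Vz : U (pi a (scale I 0 z)) by rewrite pi_scale tpow0.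
have Q1 : 0 < Rabs Q + 1 by have := Rabs_pos Q; lra.
have [r [r0 Hr]] := cont_onP (open_pi oU) cfs Vz (Rdiv_lt_0_compat _ _ e0
   (Rmult_lt_0_compat _ _ Rlt_0_2 Q1)).
set M := \big[Rplus/0]_(i < n) Rabs (z i) ^ 1.
have M0 : 0 <= M by exact: sum_pow_ge0.
have K0 := Rabs_pos K.
(* The three entries allow the expansion, the continuity estimate for [fs], and an error [K * t] of
   at most [e / 2]. *)
pose t := Rmin (d / 2) (Rmin (r / (2 * (M + 1))) (e / (2 * (Rabs K + 1)))).
have t0 : 0 < t by do !apply: Rmin_pos; try apply: Rdiv_lt_0_compat; lra.
have t1 : t <= d / 2 by exact: Rmin_l.
have t2 : t <= r / (2 * (M + 1)) by apply: Rle_trans (Rmin_r _ _) (Rmin_l _ _).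
have t3 : t <= e / (2 * (Rabs K + 1)) by apply: Rle_trans (Rmin_r _ _) (Rmin_r _ _).
have td : 0 < t < d by lra.
have [Ut] := Hd t td.
rewrite -pi_scale in Ut *; rewrite fac // prod_scale -/Q -/l.
set F := fs (scale I t z) => hb.
have hF : Rabs (F - fs (scale I 0 z)) < e / (2 * (Rabs Q + 1)).
  apply: (proj2 (Hr _ _)) => j; rewrite /scale; case: (I j); last by rewrite Rminus_diag Rabs_R0.
  rewrite Rmult_0_l Rminus_0_r Rabs_mult (Rabs_right t); last lra.
  have zM : Rabs (z j) <= M by have := sum_pow_ge z j 1; rewrite pow_1.
  have : t * (M + 1) <= r / 2.
    have M1 : 0 <= M + 1 by lra.
    have := Rmult_le_compat_r (M + 1) _ _ M1 t2.
    by rewrite (_ : r / _ * _ = r / 2) //; field; lra.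
  have := Rabs_pos (z j); nra.
have tl : 0 < t ^ l by exact: pow_lt.
have hb2 : Rabs (Q * F - X) <= K * t.
  apply: (Rmult_le_reg_l (t ^ l)) => //.
  rewrite -{1}(Rabs_right (t ^ l)); last lra.
  rewrite -Rabs_mult (_ : t ^ l * (Q * F - X) = t ^ l * Q * F - t ^ l * X); last ring.
  by apply: Rle_trans hb _; rewrite /=; apply: Req_le; ring.
have hK : K * t <= e / 2.
  have h1 : K * t <= (Rabs K + 1) * t.
    by apply: Rmult_le_compat_r; [lra|have := Rle_abs K; lra].
  have K1 : 0 <= Rabs K + 1 by lra.
  have := Rmult_le_compat_l (Rabs K + 1) _ _ K1 t3.
  rewrite (_ : (Rabs K + 1) * (e / _) = e / 2); [lra|field; lra].
have hQ : Rabs (Q * (F - fs (scale I 0 z))) < e / 2.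
  rewrite Rabs_mult; apply: (Rle_lt_trans _ (Rabs Q * (e / (2 * (Rabs Q + 1))))).
    by apply: Rmult_le_compat_l; [exact: Rabs_pos|lra].
  apply: (Rlt_le_trans _ ((Rabs Q + 1) * (e / (2 * (Rabs Q + 1))))).
    by apply: Rmult_lt_compat_r; [apply: Rdiv_lt_0_compat; lra|lra].
  by apply: Req_le; field; lra.
have := Rabs_triang (X - Q * F) (Q * (F - fs (scale I 0 z))).
rewrite (_ : _ + _ = X - Q * fs (scale I 0 z)); last ring.
rewrite -/e (Rabs_minus_sym X); lra.
Qed.

Lemma pi_vanishes U f lv j : is_open U -> hatE U f ->
  lmin (Newton U f) (natv (a j)) (INR (lv j)) ->
  vanishes (fun y => U (pi a y)) (fun y => f (pi a y)) j (lv j).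
Proof.
move=> oU [sf adm] [_ lP] y Uy yj _.
pose g x := Newton U f x /\ dotR (Zv (natZ (a j))) x = IZR (Z.of_nat (lv j)).
have vP : valid (Newton U f) (natZ (a j)) (Z.of_nat (lv j)).
  by move=> x /lP; rewrite Zv_natZ -INR_IZR_INZ.
have dg : defines (Newton U f) (natZ (a j)) (Z.of_nat (lv j)) g by [].
have [s [s0 Hs]] := open_upd j (open_pi oU) Uy; rewrite yj in Hs.
have Us t : 0 < t < s -> U (pi a (upd y j t)).
  by move=> ts; apply: Hs; rewrite Rminus_0_r Rabs_right; lra.
have s2 : 0 < s / 2 < s by lra.
(* The scaling starts at coordinate [s / 2], off the wall; a start on the wall would leave that
   coordinate at 0. *)
have [|L HL] := adm g _ (a j) (lv j) vP dg _ (Us _ s2); first by exists (natZ (a j)), (Z.of_nat (lv j)).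
have [del [del0 Hdel]] := HL 1 Rlt_0_1.
(* With [u = t * (s / 2)] the quotient by [t ^ lv j] lies within 1 of [L]; the power of [s / 2]
   converts [t] back to [u]. *)
exists ((Rabs L + 1) / (s / 2) ^ lv j), (Rmin 1 del * (s / 2)); split.
  by apply: Rmult_lt_0_compat; [apply: Rmin_pos|]; lra.
move=> u [u0 ud]; set t := u / (s / 2).
have ut : u = t * (s / 2) by rewrite /t; field; lra.
have t0 : 0 < t by apply: Rdiv_lt_0_compat; lra.
have tm : t < Rmin 1 del by apply: (Rmult_lt_reg_r (s / 2)); [lra|rewrite -ut].
have t1 := Rlt_le_trans _ _ _ tm (Rmin_l _ _).
have td := Rlt_le_trans _ _ _ tm (Rmin_r _ _).
have := Hdel t; rewrite /= /Rdist -pi_upd -ut => H.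
have {}H : Rabs (f (pi a (upd y j u)) / t ^ lv j - L) < 1.
  apply: H; split; last by rewrite Rminus_0_r Rabs_right; lra.
  by split=> //; apply: Us; split=> //; rewrite ut; nra.
have tl : 0 < t ^ lv j by exact: pow_lt.
have sl : 0 < (s / 2) ^ lv j by apply: pow_lt; lra.
rewrite ut Rpow_mult_distr -ut.
rewrite (_ : _ / _ * _ = (Rabs L + 1) * t ^ lv j); last by field; lra.
set v := f _ in H *.
have -> : v = v / t ^ lv j * t ^ lv j by field; lra.
rewrite Rabs_mult (Rabs_right (t ^ _)); last lra.
by apply: Rmult_le_compat_r; [lra|move: H; split_Rabs; lra].
Qed.

Lemma count_mlist (lv : mindex n) j : count_mem j (mlist lv) = lv j.
Proof.
rewrite /mlist; have : j \in enum 'I_n by rewrite mem_enum.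
elim: (enum 'I_n) (enum_uniq 'I_n) => [|i s IH] //= /andP [is_ us].
rewrite in_cons count_cat count_nseq /=; case: eqP => [e _|ne /= js].
  subst i; rewrite eqxx mul1n (_ : count _ _ = 0%N) ?addn0 //.
  apply/eqP; rewrite -leqn0 leqNgt -has_count; apply/hasPn => k /flatten_mapP [i hi].
  by rewrite mem_nseq => /andP [_ /eqP ->]; apply/eqP => e; subst i; rewrite hi in is_.
by rewrite IH //; case: eqP ne => // ->.
Qed.

Lemma prod_mlist (lv : mindex n) y :
  \big[Rmult/1]_(j <- mlist lv) y j = \big[Rmult/1]_(j < n) y j ^ lv j.
Proof.
rewrite /mlist big_flatten big_map big_enum /=; apply: eq_bigr => j _.
by elim: (lv j) => [|m IH] /=; rewrite ?big_nil ?big_cons ?IH.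
Qed.

End Monomial.

Lemma sum_le_eq n (F G : 'I_n -> R) : (forall i, F i <= G i) ->
  \big[Rplus/0]_(i < n) G i = \big[Rplus/0]_(i < n) F i -> forall i, G i = F i.
Proof.
move=> FG E i; move: E; rewrite (bigD1 i) //= [in RHS](bigD1 i) //=.
set X := bigop _ _ _; set Y := bigop _ _ _.
have XY : Y <= X by rewrite /X /Y; elim/big_ind2: _ => [|u v u' v'|k _]; [lra|lra|exact: FG].
by have := FG i; lra.
Qed.

(** * The factorization over a cone of the subdivision and its zeros *)

Section Resolution.
Variables (n : nat) (U : vec n -> Prop) (f : vec n -> R) (a : 'I_n -> mindex n).
Hypotheses (oU : is_open U) (U0 : U (zero n)).
Implicit Types (x y z : vec n) (i j k : 'I_n) (al : mindex n).

(** A vector [b] of the dual cone attains its minimum at a support point, which then lies on the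
    face [g]. Every edge vector is in the closure of that dual cone, so it is minimal there too. *)
Lemma skeleton_vertex Sig : simplicial_subdivision (Newton U f) Sig ->
  Sig (map a (enum 'I_n)) ->
  exists al, in_supp U f al /\
    forall j, lmin (Newton U f) (natv (a j)) (INR (dotn (a j) al)).
Proof.
move=> [_ [HS _]] /HS [g [_ Hg]].
(* The zero vector belongs to the cone, hence to the closure of the dual cone, which is therefore
   not empty. *)
have [b [[b0 [m [bm Hm]]] _]] : exists b, dual_cone (Newton U f) g b /\ near (zero n) b 1.
  apply: Hg; last lra.
  exists [seq 0 | _ <- enum 'I_n]; split; first by rewrite !length_map.
  split; first by apply/Forall_forall => t /in_map_iff [i [<- _]]; lra.
  move=> k; rewrite combine_map fold_right_bigE big_map big1 // => i _.
  by rewrite Rmult_0_l.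
have [al [sal eal]] := Newton_min_supp b0 bm.
exists al; split=> // j; rewrite -dotR_natv; split.
  by exists (natv al); split=> //; exact: supp_Newton.
move=> x Px; apply: closure_dual_cone_le (Hg _ (skeleton_in_cone a j)) _ Px.
by apply/Hm; split=> //; exact: supp_Newton.
Qed.

Variables (al0 : mindex n).
Hypotheses (comp : completable (map a (enum 'I_n))) (sal0 : in_supp U f al0).
Hypothesis (fh : hatE U f).

Let lv : mindex n := fun j => dotn (a j) al0.

Hypothesis lvP : forall j, lmin (Newton U f) (natv (a j)) (INR (lv j)).

Lemma weight_min I x : Newton U f x ->
  INR (\sum_(j < n | I j) lv j)%N <= dotR (natv (weight a I)) x.
Proof.
move=> Px; rewrite dotR_weight (big_morph INR (id1 := 0) (op1 := Rplus) plus_INR) //.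
elim/big_ind2: _ => [|u v u' v'|j _]; [lra|lra|].
by have [_] := lvP j; apply.
Qed.

Lemma weight_face_part I : (forall k, (0 < weight a I k)%N) ->
  exists S, gamma_part_list U f (face U f (weight a I) (\sum_(j < n | I j) lv j)) S /\
    forall x, exists K d, 0 < d /\ forall t, 0 < t < d -> U (tpow (weight a I) t x) /\
      Rabs (f (tpow (weight a I) t x) - t ^ (\sum_(j < n | I j) lv j)%N * poly_of S x)
        <= K * t ^ (\sum_(j < n | I j) lv j).+1.
Proof.
move=> w0; apply: face_expansion => //; first by case: fh.
move=> al sal; apply/leP/INR_le; rewrite -dotR_natv.
exact/weight_min/supp_Newton.
Qed.

Lemma vertex_in_face I :
  face U f (weight a I) (\sum_(j < n | I j) lv j) (natv al0).
Proof.
split; first exact: supp_Newton.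
rewrite dotR_weight (big_morph INR (id1 := 0) (op1 := Rplus) plus_INR) //.
by apply: eq_bigr => j _; rewrite dotR_natv.
Qed.

Lemma smooth_factor : exists fs, smooth_on (fun y => U (pi a y)) fs /\
  forall y, U (pi a y) -> f (pi a y) = (\big[Rmult/1]_(j < n) (y j ^ lv j)) * fs y.
Proof.
have oV := open_pi (a := a) oU.
have [||fs [sfs Efs]] := @smooth_div_seq n (mlist lv) _ (fun y => f (pi a y)) oV.
- move=> k; apply: Ck_comp oU oV _ _ _ => //; first by move=> i; exact: Ck_pi.
  by case: fh.
- by move=> j; rewrite count_mlist; exact: pi_vanishes.
by exists fs; split=> // y Uy; rewrite Efs // prod_mlist.
Qed.

Variable fs : vec n -> R.
Hypothesis sfs : smooth_on (fun y => U (pi a y)) fs.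
Hypothesis Efs :
  forall y, U (pi a y) -> f (pi a y) = (\big[Rmult/1]_(j < n) (y j ^ lv j)) * fs y.

Lemma factor_zero_neq0 : fs (zero n) <> 0.
Proof.
pose I := fun _ : 'I_n => true.
(* If coordinate [k] vanished in all edge vectors, the form picking it out would vanish on the whole
   skeleton. *)
have w0 k : (0 < weight a I k)%N.
  rewrite lt0n; apply/negP => /eqP; rewrite /weight => wk.
  pose c : vec n := fun i => if i == k then 1 else 0.
  have ck : c k = 0.
    apply: (skeleton_separates comp) => j; apply: big1 => i _; rewrite /c.
    case: eqP => [->|_]; last by rewrite Rmult_0_r.
    have ajk : (a j k <= 0)%N by rewrite -wk (bigD1 j) //= leq_addr.
    by move: ajk; rewrite leqn0 /natv => /eqP -> /=; rewrite Rmult_0_l.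
  by move: ck; rewrite /c eqxx; lra.
(* At the point with all coordinates 1 every monomial is 1, so [face_factor] equates [fs (zero n)]
   with the sum of the coefficients on the face. *)
have [S [[nd [SP Sc]] HS]] := weight_face_part w0.
have := face_factor oU U0 (sfs 0%N) Efs w0 HS (fun _ => 1).
rewrite (_ : scale I 0 _ = zero n); last first.
  by apply: functional_extensionality => j; rewrite /scale /= Rmult_0_l.
rewrite big1; last by move=> j _; rewrite pow1.
rewrite Rmult_1_l => <-.
have uniq_al al : face U f (weight a I) (\sum_(j < n | I j) lv j) (natv al) -> al = al0.
  move=> [Pal Eal].
  (* Equality in the sum of these inequalities forces equality in each, and then the skeleton
     separates [al] from [al0]. *)
  have ge j : INR (lv j) <= dotR (natv (a j)) (natv al) by have [_] := lvP j; apply.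
  have eqj j : dotR (natv (a j)) (natv al) = INR (lv j).
    apply: (sum_le_eq ge); move: Eal.
    by rewrite dotR_weight (big_morph INR (id1 := 0) (op1 := Rplus) plus_INR).
  apply: functional_extensionality => k; apply: INR_eq.
  suff : natv al k + -1 * natv al0 k = 0 by rewrite /natv; lra.
  apply: (skeleton_separates (c := fun k => natv al k + -1 * natv al0 k) comp) => j.
  rewrite /dotR (eq_bigr (fun i => natv (a j) i * natv al i + -1 * (natv (a j) i * natv al0 i))).
    rewrite big_split /= -big_distrr /= -!/(dotR _ _) eqj dotR_natv; rewrite /lv; ring.
  by move=> i _; ring.
have [c0 [tc0 nc0]] := sal0.
case: S nd SP Sc {HS} => [|p [|q S]] nd SP Sc.
- by have := Sc al0 (vertex_in_face I) sal0.
- have [tp gp] := SP p (or_introl erefl); have ep := uniq_al _ gp.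
  rewrite /poly_of /= /mono big1; last first.
    by move=> i _; rewrite /pi big1 ?pow1 // => j _; rewrite pow1.
  rewrite ep in tp; rewrite (taylor_coef_unique oU U0 tp tc0); lra.
- have [_ gp] := SP p (or_introl erefl); have [_ gq] := SP q (or_intror (or_introl erefl)).
  move/NoDup_cons_iff: nd => [np _] _; apply: np; left.
  by rewrite (uniq_al _ gp) (uniq_al _ gq).
Qed.

(** In logarithmic form the Jacobian of the monomial map is the exponent matrix. *)
Lemma pi_partial y j k : y j <> 0 ->
  is_derive (fun t => pi a (upd y j t) k) (y j) (INR (a j k) * pi a y k / y j).
Proof.
move=> yj; set B := \big[Rmult/1]_(i < n | i != j) (y i ^ a i k).
have E t : B * t ^ a j k = pi a (upd y j t) k.
  rewrite /pi (bigD1 j) //= updE Rmult_comm; congr Rmult; apply: eq_bigr => i ij.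
  by rewrite upd_neq.
apply: (is_derive_ext _ _ _ _ E).
rewrite (_ : _ / _ = B * (INR (a j k) * y j ^ Nat.pred (a j k))).
  by apply: is_derive_scal; apply/is_derive_Reals; exact: derivable_pt_lim_pow.
rewrite -{1}(upd_id y j) -E; case: (a j k) => [|m]; first by rewrite /=; field.
by rewrite -[y j ^ m.+1]/(y j * y j ^ m) -[Nat.pred _]/m; field.
Qed.

(* Off the coordinate hyperplanes [pi a] is a local diffeomorphism, so a critical zero of
   [fs] on the stratum is carried to a critical point of the face polynomial. *)
Lemma factor_grad_nonzero (I : 'I_n -> bool) y : nondegenerate U f ->
  (forall x, (exists y, T_I I y /\ pi a y = x) <-> x = zero n) ->
  T_I I y -> U (pi a y) -> fs y = 0 -> grad_nonzero fs (fun j => ~~ I j) y.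
Proof.
move=> nd HI TIy Uy fsy crit.
(* If the weight vanished at [k], coordinate [k] of [pi a y] would be a product of nonzero factors,
   although [pi a y] is the origin. *)
have w0 k : (0 < weight a I k)%N.
  rewrite lt0n; apply/negP => /eqP wk.
  have : pi a y k = 0 by rewrite (proj1 (HI (pi a y))) //; exists y.
  apply: prod_neq0 => j; case Ij : (I j).
    have ajk : (a j k <= 0)%N by rewrite -wk /weight (bigD1 j) //= leq_addr.
    by move: ajk; rewrite leqn0 => /eqP -> /=; lra.
  by apply: pow_nonzero => yj; move/TIy: yj; rewrite Ij.
have [S [HSg HS]] := weight_face_part w0.
have fac := face_factor oU U0 (sfs 0%N) Efs w0 HS.
(* The zero coordinates are replaced by 1 and then scaled by [d / 2]. The result [y'] lies in the
   torus, keeps the coordinates outside [I], and has its image in [U]. *)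
pose y1 : vec n := fun j => if I j then 1 else y j.
have [K [d [d0 Hd]]] := HS (pi a y1).
pose y' := scale I (d / 2) y1.
have y'0 j : y' j <> 0.
  rewrite /y' /scale /y1; case Ij : (I j); first lra.
  by move/TIy; rewrite Ij.
have Uy' : U (pi a y').
  have d2 : 0 < d / 2 < d by lra.
  by rewrite /y' pi_scale; have [] := Hd _ d2.
have yz j t : scale I 0 (upd y' j t) = if I j then y else upd y j t.
  apply: functional_extensionality => i; have yI k : I k -> y k = 0 by move/TIy.
  rewrite /scale; have [->|/eqP ij] := @eqP _ i j.
    by rewrite updE; case Ij : (I j); rewrite ?updE // Rmult_0_l yI.
  rewrite upd_neq // [RHS](_ : _ = y i); last by case: (I j); rewrite ?upd_neq.
  by rewrite /y' /scale /y1; case Ii : (I i); rewrite // Rmult_0_l yI.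
have yj j : ~~ I j -> y' j = y j by rewrite /y' /scale /y1 => /negbTE ->.
(* For [j] in [I] the second factor of [face_factor] stays at [fs y = 0]. Otherwise the product rule
   applies, with [fs y] and its derivative along [j] both zero. *)
have Fder j : is_derive (fun t => poly_of S (pi a (upd y' j t))) (y' j) 0.
  pose Q t := \big[Rmult/1]_(i < n) (upd y' j t i ^ lv i).
  have E t : Q t * fs (if I j then y else upd y j t) = poly_of S (pi a (upd y' j t)).
    by rewrite fac yz.
  apply: (is_derive_ext _ _ _ _ E); case Ij : (I j).
    apply: (@is_derive_ext _ _ (fun _ => 0)); last exact: is_derive_const.
    by move=> t; rewrite fsy Rmult_0_r.
  have /is_derive_Reals := crit j (negbT Ij); rewrite -yj ?Ij // => D.
  have [dQ HQ] : exists dQ, is_derive Q (y' j) dQ.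
    have /(Ck_succ _ _ (@open_full n)) [_ /(_ j) [HP _]] :
        Ck 1 (fun _ => True) (fun y => \big[Rmult/1]_(i < n) (y i ^ lv i)).
      by apply: Ck_prod => i; apply: Ck_pow; exact: Ck_coord.
    by eexists; apply/is_derive_Reals; exact: (HP y' Logic.I).
  rewrite (_ : 0 = plus (mult dQ (fs (upd y j (y' j)))) (mult (Q (y' j)) 0)).
    by apply: (@is_derive_mult _ Q (fun t => fs (upd y j t))) => // u v; exact: Rmult_comm.
  by rewrite yj ?Ij // upd_id fsy /plus /mult /=; ring.
have gface : compact_face (Newton U f) (face U f (weight a I) (\sum_(j < n | I j) lv j)).
  split; last split; last 1 first.
  (* Compactness: weights of at least 1 and nonnegative coordinates bound each coordinate by the
     value of the form. *)
  - exists (INR (\sum_(j < n | I j) lv j)%N) => x [Px <-] i.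
    have xi := Newton_ge0 _ Px.
    rewrite Rabs_right; last exact/Rle_ge.
    rewrite /dotR (bigD1 i) //= -[X in X <= _]Rplus_0_r; apply: Rplus_le_compat.
      rewrite -[X in X <= _]Rmult_1_l; apply: Rmult_le_compat_r => //.
      by rewrite /natv -[1]/(INR 1); apply/le_INR/ltP.
    elim/big_ind: _ => [|u v|k _]; [lra|lra|].
    by apply: Rmult_le_pos => //; exact: pos_INR.
  - exists (natZ (weight a I)), (Z.of_nat (\sum_(j < n | I j) lv j)).
    split=> x; rewrite Zv_natZ -INR_IZR_INZ; last by [].
    exact: weight_min.
  - by exists (natv al0); exact: vertex_in_face.
set x := pi a y'.
have x0 k : x k <> 0 by apply: prod_neq0 => j; exact: pow_nonzero.
apply: (nd _ gface S HSg x Uy' x0) => k _.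
have C1 := Ck_poly 1 (fun _ => True) S.
have /(Ck_succ _ _ (@open_full n)) [_ /(_ k) [HP _]] := C1.
suff E : pd (poly_of S) k x = 0 by rewrite -E; exact: (HP x Logic.I).
(* By [pi_partial] the logarithmic gradient, with entries [pd (poly_of S) k x * x k], pairs to zero
   with every edge vector. *)
suff : pd (poly_of S) k x * x k = 0 by move=> /Rmult_integral [] // /x0.
apply: (skeleton_separates (c := fun k => pd (poly_of S) k x * x k) comp) => j.
have := @chain_rule n (fun _ => True) (poly_of S) (fun t => pi a (upd y' j t)) (y' j)
  (fun k => INR (a j k) * x k / y' j) (@open_full n) C1 Logic.I (fun k => pi_partial k (y'0 j)).
move=> /is_derive_unique; rewrite (is_derive_unique _ _ _ (Fder j)) upd_id -/x => E.
apply: (Rmult_eq_reg_l (/ y' j)); last exact: Rinv_neq_0_compat.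
rewrite Rmult_0_r [RHS]E /dotR big_distrr /=; apply: eq_bigr => i _.
by rewrite /natv /Rdiv; ring.
Qed.

End Resolution.

Theorem theorem8p10 (n : nat) (U : vec n -> Prop) (f : vec n -> R)
    (Sig : list (mindex n) -> Prop) (a : 'I_n -> mindex n) :
  is_open U -> U (zero n) -> hatE U f -> (exists x, Newton U f x) ->
  simplicial_subdivision (Newton U f) Sig -> Sig (map a (enum 'I_n)) ->
  exists lv : 'I_n -> nat,
    (forall j, lmin (Newton U f) (natv (a j)) (INR (lv j))) /\
    exists fs : vec n -> R,
      smooth_on (fun y => U (pi a y)) fs /\ fs (zero n) <> 0 /\
      (forall y, U (pi a y) ->
         f (pi a y) = (\big[Rmult/1]_(j < n) (y j ^ lv j)) * fs y) /\
      (nondegenerate U f ->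
       forall I : 'I_n -> bool,
         (forall x, (exists y, T_I I y /\ pi a y = x) <-> x = zero n) ->
         forall y, T_I I y -> U (pi a y) -> fs y = 0 ->
           grad_nonzero fs (fun j => ~~ I j) y).
Proof.
move=> oU U0 fh _ sub Siga.
have [al0 [sal0 lvP]] := skeleton_vertex sub Siga.
have comp : completable (map a (enum 'I_n)) by case: sub => _ [_]; apply.
exists (fun j => dotn (a j) al0); split=> //.
have [fs [sfs Efs]] := smooth_factor oU fh lvP.
exists fs; split=> //; split; first exact: factor_zero_neq0 Efs.
split=> // nd I HI y; exact: (factor_grad_nonzero oU U0 comp sal0 fh lvP sfs Efs nd HI).
Qed.
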